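(* Let $\varphi\in L^\infty(\mathbb{T}^\infty)$ be a real-valued function, and let $\{\sigma_N\}_{N=1}^\infty$ be a multiplicative Følner sequence of non-empty finite subsets of $\mathbb{N}$. Then for any function $f$, continuous on $[\operatorname{ess\,inf}\varphi,\operatorname{ess\,sup}\varphi]$, we have $$ \lim_{N\to\infty}\frac{1}{\#\sigma_N}\operatorname{Tr} f(\mathbf{T}_{\sigma_N}(\varphi))=\int_{\mathbb{T}^\infty} f(\varphi(z))\,d\mathbf{m}(z). $$
   Context: $\mathbb{N}=\{1,2,\dots\}$, and $\#X$ is the cardinality of a finite set $X$. $\mathbb{T}$ is the unit circle in $\mathbb{C}$, and $\mathbb{T}^\infty$ is the product of countably many copies of $\mathbb{T}$ with the product topology, a compact abelian group with normalised Haar measure $\mathbf{m}$; $L^p(\mathbb{T}^\infty)$, $\operatorname{ess\,inf}$ and $\operatorname{ess\,sup}$ are taken with respect to $\mathbf{m}$. $\mathbb{Z}^{(\infty)}$ is the set of integer sequences $\alpha=(\alpha_1,\alpha_2,\dots)$ with only finitely many non-zero entries; $z^\alpha=z_1^{\alpha_1}z_2^{\alpha_2}\cdots$ for $z\in\mathbb{T}^\infty$. Let $p_1<p_2<\dots$ be the primes; every positive rational $q$ is uniquely $q=p^\alpha:=p_1^{\alpha_1}p_2^{\alpha_2}\cdots$ with $\alpha\in\mathbb{Z}^{(\infty)}$. The Fourier coefficients of $\varphi\in L^2(\mathbb{T}^\infty)$ are labelled by positive rationals: $\widehat\varphi(p^\alpha)=\int_{\mathbb{T}^\infty}\varphi(z)\overline{z^\alpha}\,d\mathbf{m}(z)$.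 For a finite set $\sigma\subset\mathbb{N}$, $\mathbf{T}_\sigma(\varphi)$ is the matrix $\{\widehat\varphi(j/k)\}_{j,k\in\sigma}$. It is Hermitian if $\varphi$ is real-valued, its spectrum then lies in $[\operatorname{ess\,inf}\varphi,\operatorname{ess\,sup}\varphi]$, and $f(\mathbf{T}_\sigma(\varphi))$ is defined by the functional calculus. A sequence $\{\sigma_N\}_{N=1}^\infty$ of non-empty finite subsets of $\mathbb{N}$ is a multiplicative Følner sequence if for every $n\in\mathbb{N}$, $\#\{k\in\sigma_N: nk\in\sigma_N\}/\#\sigma_N\to1$ as $N\to\infty$. (The sets are not required to be nested or to exhaust $\mathbb{N}$.) *)

(* Defs.v *)
From HB Require Import structures.
From mathcomp Require Import all_boot all_order all_algebra.
From mathcomp Require Import spectral complex finmap.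
From mathcomp Require Import all_classical all_reals all_analysis ess_sup_inf.

Set Implicit Arguments.
Unset Strict Implicit.
Unset Printing Implicit Defensive.

Import Order.TTheory GRing.Theory Num.Theory.
Import numFieldNormedType.Exports.

Local Open Scope classical_set_scope.
Local Open Scope ring_scope.
Local Open Scope complex_scope.

(* [R[i]^o] is [R[i]] with its usual norm topology. *)
Definition unit_circle (R : realType) : set R[i]^o := [set z | `|z| = 1].

Definition circle (R : realType) : Type := set_type (@unit_circle R).

HB.instance Definition _ (R : realType) :=
  Topological.copy (circle R) (set_type (@unit_circle R)).

Definition circle_val (R : realType) (z : circle R) : R[i] := set_val z.

Lemma mem_circle (R : realType) (z : R[i]) :
  `|z| = 1 -> (z : R[i]^o) \in @unit_circle R.
Proof. exact: mem_set. Qed.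

Definition Circle (R : realType) (z : R[i]) (hz : `|z| = 1) : circle R :=
  exist (fun x => x \in @unit_circle R) z (mem_circle hz).

Lemma norm_circle (R : realType) (z : circle R) : `|circle_val z| = 1.
Proof. by case: z => z hz; exact: (set_mem hz). Qed.

HB.instance Definition _ (R : realType) :=
  isPointed.Build (circle R) (Circle (normr1 R[i])).

Lemma norm_circleM (R : realType) (z w : circle R) :
  `|circle_val z * circle_val w| = 1.
Proof. by rewrite normrM !norm_circle mulr1. Qed.

Definition circle_mul (R : realType) (z w : circle R) : circle R :=
  Circle (norm_circleM z w).

(* Coordinates are numbered from 0: the 0-th one goes with the prime 2. *)
Definition torus (R : realType) : Type := {ptws nat -> circle R}.

HB.instance Definition _ (R : realType) :=
  Topological.copy (torus R) {ptws nat -> circle R}.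

HB.instance Definition _ (R : realType) :=
  isPointed.Build (torus R) (fun=> point).

Definition torus_mul (R : realType) (z w : torus R) : torus R :=
  fun i => circle_mul (z i) (w i).

Definition borel_torus (R : realType) := g_sigma_algebraType (@open (torus R)).

(* On a compact metrizable group every Borel probability measure is regular, so
   this determines the normalised Haar measure. *)
Definition is_haar (R : realType) (m : probability (borel_torus R) R) : Prop :=
  forall (w : torus R) (A : set (borel_torus R)), measurable A ->
    m (torus_mul w @` A) = m A.

Definition Cintegral d (T : measurableType d) (R : realType)
    (m : {measure set T -> \bar R}) (g : T -> R[i]) : R[i] :=
  (\int[m]_x complex.Re (g x)) +i* (\int[m]_x complex.Im (g x)).

Lemma next_prime_subproof (n : nat) : exists p, prime p && (n < p)%N.
Proof. by have [p np pp] := prime_above n; exists p; rewrite pp np. Qed.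

Definition next_prime (n : nat) : nat := ex_minn (next_prime_subproof n).

Fixpoint nth_prime (i : nat) : nat :=
  if i is j.+1 then next_prime (nth_prime j) else 2.

(* The sequence alpha with p ^ alpha = q, for q > 0. *)
Definition prime_exponents (q : rat) (i : nat) : int :=
  (logn (nth_prime i) `|numq q|)%:Z - (logn (nth_prime i) `|denq q|)%:Z.

(* The big operator is a product over a set with finite support, so this is
   z ^ alpha for alpha with finitely many nonzero entries. *)
Definition character (R : realType) (alpha : nat -> int) (z : torus R) : R[i] :=
  \big[*%R/1]_(i \in [set i | alpha i != 0]) (circle_val (z i) ^ alpha i).

Definition fourier_coef (R : realType) (m : probability (borel_torus R) R)
    (phi : borel_torus R -> R[i]) (q : rat) : R[i] :=
  Cintegral m (fun z => phi z * (character (prime_exponents q) z)^*).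

(* T_sigma(phi), with sigma listed in the order of its enumeration. *)
Definition toeplitz (R : realType) (m : probability (borel_torus R) R)
    (phi : borel_torus R -> R[i]) (sigma : {fset nat}) : 'M[R[i]]_#|` sigma| :=
  \matrix_(a, b) fourier_coef m phi
    ((nth 0%N sigma a)%:R / (nth 0%N sigma b)%:R).

(* Functional calculus of a Hermitian matrix, whose eigenvalues are real, by
   diagonalisation in an orthonormal basis: [spectralmx A] is unitary and
   A = (spectralmx A)^-1 * diag (spectral_diag A) * spectralmx A. *)
Definition hermitian_fun (R : realType) (f : R -> R[i]) (n : nat)
    (A : 'M[R[i]]_n) : 'M[R[i]]_n :=
  invmx (spectralmx A)
    *m diag_mx (map_mx (fun x => f (complex.Re x)) (spectral_diag A))
    *m spectralmx A.

Definition multiplicative_folner (R : realType) (sigma : nat -> {fset nat})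
    : Prop :=
  [/\ forall N, sigma N != fset0,
      forall N k, k \in sigma N -> (0 < k)%N &
      forall n, (0 < n)%N ->
        (#|` [fset k in sigma N | (n * k)%N \in sigma N]%fset|%:R
          / #|` sigma N|%:R : R) @[N --> \oo] --> (1 : R)].

(* The values of f outside the interval do not matter: phi takes values in it
   almost everywhere, and the spectra of the matrices lie in it. *)
Definition ess_range_itv (R : realType) (m : probability (borel_torus R) R)
    (phi : borel_torus R -> R) : set R :=
  [set x | (ess_inf m (EFin \o phi) <= x%:E <= ess_sup m (EFin \o phi))%E].

(* Main.v *)
(* T_sigma(phi) is the compression of multiplication by phi to the span of the
   characters e_k, k in sigma.  Let lam_i be its eigenvalues, u_i an orthonormal
   eigenbasis seen in that span, w_i = |u_i|^2 and n = #sigma.  Then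
   sum_i w_i = sum_k |e_k|^2 = n pointwise, int w_i = 1 and int phi w_i = lam_i.
   On [ess inf phi, ess sup phi], |f x - f y| <= eps + C (x - y)^2, hence
     |n int f(phi) - sum_i f(lam_i)| <= sum_i int |f(phi) - f(lam_i)| w_i
       <= eps n + C (n int phi^2 - sum_i lam_i^2).
   It remains to see that (1/n) sum_i lam_i^2, that is
   (1/n) sum_(j, k in sigma) |phi^(j/k)|^2, tends to int phi^2: by the Folner
   property each rational q is a quotient j/k of n (1 - o(1)) pairs of sigma, and
   Parseval's identity gives the limit.
     Parseval's identity needs the density of trigonometric polynomials in L^2.
   The bounded functions that they approximate form an algebra closed under
   bounded pointwise limits; it contains the sign of each of its elements, so the
   sets whose indicators it contains form a sigma-algebra containing the open
   sets. *)

Require Import Defs.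
From mathcomp Require Import all_boot all_order all_algebra.
From mathcomp Require Import complex finmap zify ring lra spectral.
From mathcomp Require Import all_classical all_reals all_analysis measurable_realfun ess_sup_inf.
Import Order.TTheory GRing.Theory Num.Theory.
Import numFieldNormedType.Exports.
Set Implicit Arguments.
Unset Strict Implicit.
Unset Printing Implicit Defensive.
Local Open Scope classical_set_scope.
Local Open Scope ring_scope.
Local Open Scope complex_scope.
(* Operands of [*] are parsed in [ring_scope], where [^*] would otherwise be [Num.conj]. *)
Local Notation "z ^*" := (conjc z) : ring_scope.

(** * Prime exponents and characters *)

Lemma next_primeP n :
  [/\ prime (next_prime n), (n < next_prime n)%N &
      forall p, prime p -> (n < p)%N -> (next_prime n <= p)%N].
Proof.
rewrite /next_prime; case: ex_minnP => p /andP[pp np] pmin.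
by split=> // q qp nq; apply: pmin; rewrite qp nq.
Qed.

Lemma prime_nth_prime i : prime (nth_prime i).
Proof. by case: i => [|i] //=; have [] := next_primeP (nth_prime i). Qed.

Lemma nth_prime_ltS i : (nth_prime i < nth_prime i.+1)%N.
Proof. by have [] := next_primeP (nth_prime i). Qed.

Lemma ltn_nth_prime : {homo nth_prime : i j / (i < j)%N}.
Proof. by apply: homo_ltn => [|i]; [exact: ltn_trans|exact: nth_prime_ltS]. Qed.

Lemma nth_prime_inj : injective nth_prime.
Proof.
move=> i j ij; apply/eqP; rewrite eqn_leq; apply/andP; split;
  by rewrite leqNgt; apply/negP => /ltn_nth_prime; rewrite ij ltnn.
Qed.

Lemma nth_prime_gt i : (i < nth_prime i)%N.
Proof.
by elim: i => // i ih; apply: leq_ltn_trans ih (nth_prime_ltS i).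
Qed.

Lemma nth_prime_surj p : prime p -> exists i, nth_prime i = p.
Proof.
move=> pp; have /ex_minnP[i pi imin] : exists i, (p <= nth_prime i)%N.
  by exists p; apply/ltnW/nth_prime_gt.
exists i; apply/eqP; rewrite eqn_leq pi andbT.
case: i pi imin => [|i] pi imin; first exact: prime_gt1.
have [_ _ h] := next_primeP (nth_prime i); apply: h => //.
by rewrite ltnNge; apply/negP => /imin; rewrite ltnn.
Qed.

(** Cross-multiplication gives [numq q * b = a * denq q] up to absolute values, and valuations are
    additive; this covers unreduced fractions. *)
Lemma prime_exponents_frac a b i : (0 < a)%N -> (0 < b)%N ->
  prime_exponents (a%:R / b%:R) i =
    (logn (nth_prime i) a)%:Z - (logn (nth_prime i) b)%:Z.
Proof.
move=> a0 b0; rewrite /prime_exponents; set q := _ / _.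
have b0' : b%:R != 0 :> rat by rewrite pnatr_eq0 -lt0n.
have q0 : 0 < q by rewrite divr_gt0 // ltr0n.
have n0 : (0 < `|numq q|)%N by rewrite absz_gt0 gt_eqF // numq_gt0.
have d0 : (0 < `|denq q|)%N by rewrite absz_gt0 denq_eq0.
suff h : (`|numq q| * b = a * `|denq q|)%N.
  have := congr1 (logn (nth_prime i)) h; rewrite !lognM //; lia.
have h : (numq q * b%:Z)%:~R = (a%:Z * denq q)%:~R :> rat.
  rewrite !intrM -!pmulrn.
  have h := divq_num_den q.
  have dq0 : (denq q)%:~R != 0 :> rat by rewrite intr_eq0 denq_eq0.
  have -> : (numq q)%:~R = q * (denq q)%:~R by rewrite -{2}h mulfVK.
  by rewrite mulrAC /q mulfVK.
have /(congr1 absz) := intr_inj h; by rewrite !abszM !absz_nat.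
Qed.

Lemma pos_ratP (q : rat) : 0 < q ->
  exists a b, [/\ (0 < a)%N, (0 < b)%N & q = a%:R / b%:R].
Proof.
move=> q0; exists `|numq q|%N, `|denq q|%N; split.
- by rewrite absz_gt0 gt_eqF // numq_gt0.
- by rewrite absz_gt0 denq_eq0.
rewrite -{1}[q]divq_num_den !pmulrn !gez0_abs //.
by rewrite ltW // numq_gt0.
Qed.

Lemma prime_exponentsM (q r : rat) i : 0 < q -> 0 < r ->
  prime_exponents (q * r) i = prime_exponents q i + prime_exponents r i.
Proof.
move=> /pos_ratP[a [b [a0 b0 ->]]] /pos_ratP[c [d [c0 d0 ->]]].
have -> : a%:R / b%:R * (c%:R / d%:R) = (a * c)%:R / (b * d)%:R :> rat.
  by rewrite mulf_div -!natrM.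
rewrite !prime_exponents_frac ?muln_gt0 ?a0 ?b0 // !lognM //; lia.
Qed.

Lemma prime_exponents1 i : prime_exponents 1 i = 0.
Proof.
by have := @prime_exponents_frac 1 1 i isT isT; rewrite divr1 subrr.
Qed.

Lemma prime_exponents_prime j i :
  prime_exponents (nth_prime j)%:R i = (i == j).
Proof.
rewrite -[X in prime_exponents X]divr1 (@prime_exponents_frac _ 1) //.
  rewrite logn1 subr0 logn_prime ?prime_nth_prime // eq_sym.
  by rewrite (inj_eq nth_prime_inj) eq_sym.
exact/prime_gt0/prime_nth_prime.
Qed.

Lemma prime_exponents_finite (q : rat) : 0 < q ->
  exists N, forall i, (N <= i)%N -> prime_exponents q i = 0.
Proof.
move=> /pos_ratP[a [b [a0 b0 ->]]]; exists (a + b)%N => i Ni.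
have h n : (0 < n)%N -> (n <= i)%N -> logn (nth_prime i) n = 0%N.
  move=> n0 ni; apply/eqP; rewrite -leqn0 leqNgt logn_gt0 mem_primes n0.
  rewrite prime_nth_prime; apply/negP => /(dvdn_leq n0).
  by rewrite leqNgt (leq_ltn_trans ni (nth_prime_gt i)).
by rewrite prime_exponents_frac // !h // ?subrr //; lia.
Qed.

(** Unique factorisation: a numerator and a denominator with the same valuation at every prime are
    equal. *)
Lemma prime_exponents_neq0 (q : rat) : 0 < q -> q != 1 ->
  exists i, prime_exponents q i != 0.
Proof.
move=> /pos_ratP[a [b [a0 b0 ->]]] q1; apply: contrapT => /forallNP h.
have /eqP : a != b by apply: contraNneq q1 => ->; rewrite divff // pnatr_eq0 -lt0n.
apply; apply/eqn_from_log => // p.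
have [pp|pp] := boolP (prime p); last by rewrite lognE [RHS]lognE (negbTE pp).
have [i <-] := nth_prime_surj pp; have /negP := h i; rewrite negbK.
by rewrite prime_exponents_frac // subr_eq0 => /eqP [].
Qed.

Section characters.
Variable R : realType.
Implicit Types (z w : torus R) (q r : rat).

Lemma circle_val_neq0 (x : circle R) : circle_val x != 0.
Proof. by rewrite -normr_eq0 norm_circle oner_neq0. Qed.

Lemma characterE (alpha : nat -> int) N z :
  (forall i, (N <= i)%N -> alpha i = 0) ->
  character alpha z = \prod_(i < N) circle_val (z i) ^ alpha i.
Proof.
move=> h; rewrite /character.
rewrite -(big_mkord xpredT (fun i => circle_val (z i) ^ alpha i)).
rewrite [RHS]fsbig_seq ?iota_uniq //; apply: fsbig_widen => i /=.
  move=> ai; rewrite mem_index_iota /= ltnNge; apply: contra ai => /h ->.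
  by rewrite eqxx.
by move=> [_ /negP]; rewrite negbK => /eqP ->; rewrite expr0z.
Qed.

Definition chi q z : R[i] := character (prime_exponents q) z.

Lemma chiE q : 0 < q -> exists N, (forall i, (N <= i)%N -> prime_exponents q i = 0) /\
   forall z, chi q z = \prod_(i < N) circle_val (z i) ^ prime_exponents q i.
Proof.
by move=> /prime_exponents_finite[N hN]; exists N; split=> // z; exact: characterE.
Qed.

Lemma chi1 z : chi 1 z = 1.
Proof.
rewrite /chi (@characterE _ 0) ?big_ord0 // => i _.
exact: prime_exponents1.
Qed.

Lemma chiM q r z : 0 < q -> 0 < r -> chi (q * r) z = chi q z * chi r z.
Proof.
move=> q0 r0; have [N hN] := prime_exponents_finite q0.
have [M hM] := prime_exponents_finite r0.
rewrite /chi !(@characterE _ (N + M)).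
- rewrite -big_split /=; apply: eq_bigr => i _.
  by rewrite prime_exponentsM // expfzDr // circle_val_neq0.
- by move=> i Ni; apply: hM; apply: leq_trans Ni; rewrite leq_addl.
- by move=> i Ni; apply: hN; apply: leq_trans Ni; rewrite leq_addr.
- move=> i Ni; rewrite prime_exponentsM // hN ?hM ?addr0 //.
    by apply: leq_trans Ni; rewrite leq_addl.
  by apply: leq_trans Ni; rewrite leq_addr.
Qed.

Lemma norm_chi q z : 0 < q -> `|chi q z| = 1.
Proof.
move=> /chiE[N [_ ->]]; rewrite normr_prod big1 // => i _.
by case: prime_exponents => n; rewrite /exprz ?normfV normrX norm_circle expr1n ?invr1.
Qed.

Lemma chi_conj q z : 0 < q -> (chi q z)^* = chi q^-1 z.
Proof.
move=> q0; have n0 : chi q z != 0 by rewrite -normr_eq0 norm_chi // oner_eq0.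
apply: (mulfI n0); rewrite -sqr_normc norm_chi // expr1n.
by rewrite -chiM ?invr_gt0 // mulfV ?gt_eqF // chi1.
Qed.

Lemma chi_mulJ q z : 0 < q -> chi q z * (chi q z)^* = 1.
Proof. by move=> q0; rewrite -sqr_normc norm_chi // expr1n. Qed.

Lemma chi_prime i z : chi (nth_prime i)%:R z = circle_val (z i).
Proof.
rewrite /chi (@characterE _ i.+1) => [|j].
  rewrite big_ord_recr /= prime_exponents_prime eqxx expr1z big1 ?mul1r //.
  by move=> j _; rewrite prime_exponents_prime ltn_eqF.
by rewrite prime_exponents_prime => /gtn_eqF ->.
Qed.

Lemma chi_mul q w z : 0 < q -> chi q (torus_mul w z) = chi q w * chi q z.
Proof.
move=> /chiE[N [_ E]]; rewrite !E -big_split /=; apply: eq_bigr => i _.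
by rewrite expfzMl.
Qed.

(** An [n.+1]-th root of -1 lies on the circle and its [n.+1]-th power is -1, not 1; a negative
    exponent is handled by inversion. *)
Lemma circle_expz_neq1 (k : int) : k != 0 ->
  exists x : circle R, circle_val x ^ k != 1.
Proof.
have h n : exists x : circle R, circle_val x ^+ n.+1 != 1.
  have r1 : (n.+1.-root (-1 : R[i])) ^+ n.+1 = -1 by rewrite rootCK.
  have r2 : `|n.+1.-root (-1 : R[i])| = 1.
    apply/eqP; rewrite -(@pexpr_eq1 _ _ n.+1 isT (normr_ge0 _)).
    by rewrite -normrX r1 normrN1.
  exists (Circle r2); rewrite /circle_val /= r1.
  by rewrite eq_sym -subr_eq0 opprK -[1 + 1]/(2%:R) pnatr_eq0.
case: k => [[|n]|n] // _; have [x hx] := h n; exists x => //.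
by rewrite NegzE -exprnN invr_eq1.
Qed.

Lemma chi_neq1 q : 0 < q -> q != 1 -> exists w, chi q w != 1.
Proof.
move=> q0 q1; have [i hi] := prime_exponents_neq0 q0 q1.
have [x hx] := circle_expz_neq1 hi.
exists (fun j => if j == i then x else Circle (normr1 R[i])).
have [N [hN ->]] := chiE q0.
have iN : (i < N)%N by rewrite ltnNge; apply: contra hi => /hN ->.
rewrite (bigD1 (Ordinal iN)) //= eqxx big1 ?mulr1 // => j.
by rewrite -val_eqE /= => /negbTE ->; rewrite exp1rz.
Qed.

End characters.

(** * Bounded measurable functions *)

Lemma norm_lim_le (R : realType) (u : nat -> R) (l M : R) :
  u n @[n --> \oo] --> l -> (forall n, `|u n| <= M) -> `|l| <= M.
Proof.
move=> ul uM; have /cvg_norm nul := ul.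
by apply: (ler_cvg_to nul (cvg_cst M)); exact: nearW.
Qed.

Section bounded_measurable.
Context d (T : measurableType d) (R : realType) (m : probability T R).
Implicit Types (g h : T -> R) (u v : T -> R[i]).

(** The bound holds at every point, which makes closure under sums and products immediate;
    integrability follows since [m] is a probability. *)
Definition bmeas g := measurable_fun setT g /\ exists M : R, forall x, `|g x| <= M.

Lemma bmeas_cst (c : R) : bmeas (fun=> c).
Proof. by split; [exact: measurable_cst|exists `|c|]. Qed.

Lemma bmeasD g h : bmeas g -> bmeas h -> bmeas (fun x => g x + h x).
Proof.
move=> [mg [M gM]] [mh [N hN]]; split; first exact: measurable_funD.
by exists (M + N) => x; rewrite (le_trans (ler_normD _ _)) // lerD.
Qed.

Lemma bmeasM g h : bmeas g -> bmeas h -> bmeas (fun x => g x * h x).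
Proof.
move=> [mg [M gM]] [mh [N hN]]; split; first exact: measurable_funM.
by exists (M * N) => x; rewrite normrM ler_pM.
Qed.

Lemma bmeasN g : bmeas g -> bmeas (fun x => - g x).
Proof.
move=> bg; have := bmeasM (bmeas_cst (-1)) bg.
by under eq_fun do rewrite mulN1r.
Qed.

Lemma bmeasB g h : bmeas g -> bmeas h -> bmeas (fun x => g x - h x).
Proof. by move=> bg bh; apply: bmeasD => //; exact: bmeasN. Qed.

Lemma bmeasX g n : bmeas g -> bmeas (fun x => g x ^+ n).
Proof.
move=> bg; elim: n => [|n ih]; first exact: (bmeas_cst 1).
by under eq_fun do rewrite exprS; exact: bmeasM.
Qed.

Lemma bmeas_sum (I : Type) (s : seq I) (g : I -> T -> R) :
  (forall i, bmeas (g i)) -> bmeas (fun x => \sum_(i <- s) g i x).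
Proof.
move=> bg; elim: s => [|i s ih].
  by under eq_fun do rewrite big_nil; exact: bmeas_cst.
by under eq_fun do rewrite big_cons; exact: bmeasD.
Qed.

Lemma bmeas_integrable g : bmeas g -> m.-integrable setT (EFin \o g).
Proof.
move=> [mg [M gM]]; apply: measurable_bounded_integrable => //.
  by rewrite -ge0_fin_numE // fin_num_measure.
exists M; split; first exact: num_real.
by move=> N MN x _ /=; rewrite (le_trans (gM x)) // ltW.
Qed.

Lemma Rint_cst (c : R) : \int[m]_x c = c.
Proof.
rewrite Rintegral_cst //.
by have := probability_setT m => /= ->; rewrite mulr1.
Qed.

Lemma RintD g h : bmeas g -> bmeas h ->
  \int[m]_x (g x + h x) = \int[m]_x g x + \int[m]_x h x.
Proof. by move=> bg bh; rewrite RintegralD //; exact: bmeas_integrable. Qed.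

Lemma RintB g h : bmeas g -> bmeas h ->
  \int[m]_x (g x - h x) = \int[m]_x g x - \int[m]_x h x.
Proof. by move=> bg bh; rewrite RintegralB //; exact: bmeas_integrable. Qed.

Lemma RintZ (c : R) g : bmeas g -> \int[m]_x (c * g x) = c * \int[m]_x g x.
Proof. by move=> bg; rewrite RintegralZl //; exact: bmeas_integrable. Qed.

Lemma RintN g : bmeas g -> \int[m]_x (- g x) = - \int[m]_x g x.
Proof.
move=> bg; rewrite -mulN1r -RintZ //; apply: eq_Rintegral => x _.
by rewrite mulN1r.
Qed.

Lemma Rint_le g h : bmeas g -> bmeas h -> (forall x, g x <= h x) ->
  \int[m]_x g x <= \int[m]_x h x.
Proof. by move=> bg bh gh; apply: le_Rintegral => //; exact: bmeas_integrable. Qed.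

Lemma bmeas_sqrB g h : bmeas g -> bmeas h -> bmeas (fun z => (g z - h z) ^+ 2).
Proof. by move=> bg bh; apply: bmeasX; exact: bmeasB. Qed.

Lemma bmeasZ (c : R) g : bmeas g -> bmeas (fun z => c * g z).
Proof. by move=> bg; apply: bmeasM => //; exact: bmeas_cst. Qed.

Lemma Rint_le2 g h (k : T -> R) (a b : R) : bmeas g -> bmeas h -> bmeas k ->
  (forall z, k z <= a * g z + b * h z) ->
  \int[m]_z k z <= a * \int[m]_z g z + b * \int[m]_z h z.
Proof.
move=> bg bh bk kgh; rewrite -!RintZ // -RintD; [|exact: bmeasZ..].
by apply: Rint_le => //; apply: bmeasD; exact: bmeasZ.
Qed.

Lemma Rint_sum (I : Type) (s : seq I) (g : I -> T -> R) :
  (forall i, bmeas (g i)) ->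
  \int[m]_x (\sum_(i <- s) g i x) = \sum_(i <- s) \int[m]_x g i x.
Proof.
move=> bg; elim: s => [|i s ih].
  by rewrite big_nil -[RHS]Rint_cst; apply: eq_Rintegral => x _; rewrite big_nil.
rewrite big_cons -ih -RintD //; last exact: bmeas_sum.
by apply: eq_Rintegral => x _; rewrite big_cons.
Qed.

Lemma bmeas_lim (g_ : nat -> T -> R) g (M : R) :
  (forall n, measurable_fun setT (g_ n)) -> (forall n x, `|g_ n x| <= M) ->
  (forall x, g_ n x @[n --> \oo] --> g x) -> bmeas g.
Proof.
move=> mg gM gg; split.
  by apply: (measurable_fun_cvg mg) => x _; exact: gg.
by exists M => x; apply: (norm_lim_le (gg x)) => n; exact: gM.
Qed.

Lemma Rint_sqr_lim (g_ : nat -> T -> R) g (M : R) :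
  (forall n, measurable_fun setT (g_ n)) -> (forall n x, `|g_ n x| <= M) ->
  (forall x, g_ n x @[n --> \oo] --> g x) ->
  \int[m]_x ((g_ n x - g x) ^+ 2) @[n --> \oo] --> (0 : R).
Proof.
move=> mg gM gg; have bg := bmeas_lim mg gM gg.
have bgn n : bmeas (g_ n) by split => //; exists M.
have gM' x : `|g x| <= M by apply: (norm_lim_le (gg x)) => n; exact: gM.
have bd n : bmeas (fun x => (g_ n x - g x) ^+ 2).
  by apply: bmeasX; exact: bmeasB.
have [|||||_ _] := @dominated_convergence _ _ _ m setT measurableT
  (fun n x => ((g_ n x - g x) ^+ 2)%:E) (fun=> 0%E)
  (fun=> ((M + M) ^+ 2)%:E).
- by move=> n; apply/measurable_EFinP; have [] := bd n.
- exact: measurable_cst.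
- apply: aeW => x _; apply: cvg_EFin; first by apply: nearW.
  rewrite -[X in _ --> X](expr0n _ 2) -[X in X ^+ 2](subrr (g x)).
  by apply: (cvgM (cvgB _ (cvg_cst _)) (cvgB _ (cvg_cst _))); exact: gg.
- exact: (bmeas_integrable (bmeas_cst _)).
- apply: aeW => x n _; rewrite lee_fin normrX lerXn2r ?nnegrE //.
    by rewrite addr_ge0 // (le_trans _ (gM' x)).
  by rewrite (le_trans (ler_normB _ _)) // lerD.
rewrite integral0 => /fine_cvg; apply: cvg_trans.
by apply: near_eq_cvg; apply: nearW => n.
Qed.

(** * Bounded complex-valued functions *)

Definition cbmeas u :=
  bmeas (fun x => complex.Re (u x)) /\ bmeas (fun x => complex.Im (u x)).

Lemma Re_mul (a b : R[i]) :
  complex.Re (a * b) = complex.Re a * complex.Re b - complex.Im a * complex.Im b.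
Proof. by case: a b => [? ?] [? ?]. Qed.

Lemma Im_mul (a b : R[i]) :
  complex.Im (a * b) = complex.Re a * complex.Im b + complex.Im a * complex.Re b.
Proof. by case: a b => [? ?] [? ?]. Qed.

Lemma Re_add (a b : R[i]) : complex.Re (a + b) = complex.Re a + complex.Re b.
Proof. by case: a b => [? ?] [? ?]. Qed.

Lemma Im_add (a b : R[i]) : complex.Im (a + b) = complex.Im a + complex.Im b.
Proof. by case: a b => [? ?] [? ?]. Qed.

Lemma Re_conjc (a : R[i]) : complex.Re a^* = complex.Re a.
Proof. by case: a. Qed.

Lemma Im_conjc (a : R[i]) : complex.Im a^* = - complex.Im a.
Proof. by case: a. Qed.

Lemma cbmeas_cst (c : R[i]) : cbmeas (fun=> c).
Proof. by split; exact: bmeas_cst. Qed.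

Lemma cbmeas_real g : bmeas g -> cbmeas (fun x => (g x)%:C).
Proof. by move=> bg; split => //=; exact: bmeas_cst. Qed.

Lemma cbmeasD u v : cbmeas u -> cbmeas v -> cbmeas (fun x => u x + v x).
Proof.
move=> [u1 u2] [v1 v2]; split.
  by under eq_fun do rewrite Re_add; exact: bmeasD.
by under eq_fun do rewrite Im_add; exact: bmeasD.
Qed.

Lemma cbmeasM u v : cbmeas u -> cbmeas v -> cbmeas (fun x => u x * v x).
Proof.
move=> [u1 u2] [v1 v2]; split.
  by under eq_fun do rewrite Re_mul; apply: bmeasB; exact: bmeasM.
by under eq_fun do rewrite Im_mul; apply: bmeasD; exact: bmeasM.
Qed.

Lemma cbmeasJ u : cbmeas u -> cbmeas (fun x => (u x)^*).
Proof.
move=> [u1 u2]; split.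
  by under eq_fun do rewrite Re_conjc.
by under eq_fun do rewrite Im_conjc; exact: bmeasN.
Qed.

Lemma cbmeasX u n : cbmeas u -> cbmeas (fun x => u x ^+ n).
Proof.
move=> bu; elim: n => [|n ih]; first exact: (cbmeas_cst 1).
by under eq_fun do rewrite exprS; exact: cbmeasM.
Qed.

Lemma cbmeas_sum (I : Type) (s : seq I) (u : I -> T -> R[i]) :
  (forall i, cbmeas (u i)) -> cbmeas (fun x => \sum_(i <- s) u i x).
Proof.
move=> bu; elim: s => [|i s ih].
  by under eq_fun do rewrite big_nil; exact: cbmeas_cst.
by under eq_fun do rewrite big_cons; exact: cbmeasD.
Qed.

Lemma cbmeas_prod (I : Type) (s : seq I) (u : I -> T -> R[i]) :
  (forall i, cbmeas (u i)) -> cbmeas (fun x => \prod_(i <- s) u i x).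
Proof.
move=> bu; elim: s => [|i s ih].
  by under eq_fun do rewrite big_nil; exact: cbmeas_cst.
by under eq_fun do rewrite big_cons; exact: cbmeasM.
Qed.

Lemma eq_Cint u v : u =1 v -> Cintegral m u = Cintegral m v.
Proof. by move=> /funext ->. Qed.

Lemma Cint_cst (c : R[i]) : Cintegral m (fun=> c) = c.
Proof. by rewrite /Cintegral !Rint_cst; case: c. Qed.

Lemma Cint_real g : Cintegral m (fun x => (g x)%:C) = (\int[m]_x g x)%:C.
Proof. by rewrite /Cintegral /= Rint_cst. Qed.

Lemma CintD u v : cbmeas u -> cbmeas v ->
  Cintegral m (fun x => u x + v x) = Cintegral m u + Cintegral m v.
Proof.
move=> [u1 u2] [v1 v2]; rewrite /Cintegral; simpc; rewrite -!RintD //.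
by congr (_ +i* _); apply: eq_Rintegral => x _; rewrite ?Re_add ?Im_add.
Qed.

Lemma CintZ (c : R[i]) u : cbmeas u ->
  Cintegral m (fun x => c * u x) = c * Cintegral m u.
Proof.
move=> [u1 u2]; case: c => a b; rewrite /Cintegral; simpc.
have bZ (r : R) g : bmeas g -> bmeas (fun x => r * g x).
  by move=> bg; apply: bmeasM => //; exact: bmeas_cst.
congr (_ +i* _); rewrite -!RintZ //.
  by rewrite -RintB; [apply: eq_Rintegral => x _; rewrite Re_mul|exact: bZ..].
by rewrite -RintD; [apply: eq_Rintegral => x _; rewrite Im_mul|exact: bZ..].
Qed.

Lemma CintJ u : cbmeas u -> Cintegral m (fun x => (u x)^*) = (Cintegral m u)^*.
Proof.
move=> [u1 u2]; rewrite /Cintegral /= -RintN //.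
by congr (_ +i* _); apply: eq_Rintegral => x _; rewrite ?Re_conjc ?Im_conjc.
Qed.

Lemma Cint_sum (I : Type) (s : seq I) (u : I -> T -> R[i]) :
  (forall i, cbmeas (u i)) ->
  Cintegral m (fun x => \sum_(i <- s) u i x) = \sum_(i <- s) Cintegral m (u i).
Proof.
move=> bu; elim: s => [|i s ih].
  by rewrite big_nil -[RHS]Cint_cst; apply: eq_Cint => x; rewrite big_nil.
rewrite big_cons -ih -CintD //; last exact: cbmeas_sum.
by apply: eq_Cint => x; rewrite big_cons.
Qed.

End bounded_measurable.

(** * The Borel sigma-algebra of the torus *)

Section torus_borel.
Variable R : realType.
Implicit Types (z w : torus R).

Definition cre i z : R := complex.Re (circle_val (z i)).
Definition cim i z : R := complex.Im (circle_val (z i)).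

Lemma norm_le_ReIm (a : R[i]) :
  `|a| <= (`|complex.Re a| + `|complex.Im a|)%:C.
Proof.
rewrite normc_def lecR -(@ler_pXn2r _ 2) ?nnegrE ?sqrtr_ge0 ?addr_ge0 //.
rewrite sqr_sqrtr ?addr_ge0 ?sqr_ge0 // sqrrD !real_normK ?num_real //.
by rewrite lerD2r lerDl mulrn_wge0 // mulr_ge0.
Qed.

Lemma circle_seq_cvg (u : nat -> circle R) (x : circle R) :
  (forall e : R, 0 < e -> \forall n \near \oo,
     `|complex.Re (circle_val (u n)) - complex.Re (circle_val x)| < e /\
     `|complex.Im (circle_val (u n)) - complex.Im (circle_val x)| < e) ->
  u n @[n --> \oo] --> x.
Proof.
move=> h A [B [[W oW <-] Wx] sub].
have /nbhs_ballP[e e0 eW] := @open_nbhs_nbhs _ (circle_val x : R[i]^o) W (conj oW Wx).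
have eE : e = (complex.Re e)%:C by rewrite RRe_real // ger0_real // ltW.
have e0' : 0 < complex.Re e by move: e0; rewrite /= eE ltcR.
have := h (complex.Re e / 2) ltac:(by rewrite divr_gt0).
apply: filterS => n [h1 h2]; apply: sub => /=; apply: eW.
rewrite -ball_normE /= eE distrC (le_lt_trans (norm_le_ReIm _)) // ltcR.
by rewrite [ltRHS]splitr ltrD // raddfB.
Qed.

Lemma torus_seq_cvg (u : nat -> torus R) z :
  (forall i, u n i @[n --> \oo] --> z i) -> u n @[n --> \oo] --> z.
Proof.
move=> h; apply/cvg_sup => i A [B [[W oW <-] Wz] sub].
apply: (@filterS _ \oo _ _ _ (fun n => sub (u n))) => /=.
by apply: h; exact: open_nbhs_nbhs.
Qed.

(** [f] stands for the real or the imaginary part; the hypothesis makes it 1-Lipschitz, and the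
    projection to a coordinate is continuous. *)
Lemma open_coord (f : {additive R[i] -> R}) i (a b : R) :
  (forall x, `|f x|%:C <= `|x|) ->
  open [set z : torus R | a < f (circle_val (z i)) < b].
Proof.
move=> fx; pose V := [set x : R[i]^o | a < f x < b].
have oV : open V.
  rewrite openE => x /= /andP[ax xb]; apply/nbhs_ballP.
  exists (Num.min (f x - a) (b - f x))%:C.
    by rewrite /= ltcR lt_min !subr_gt0 ax.
  move=> y; rewrite -ball_normE /= => xy.
  have := le_lt_trans (fx (x - y)) xy; rewrite ltcR raddfB lt_min !ltr_norml.
  by move=> /andP[/andP[h1 h2] /andP[h3 h4]]; apply/andP; split; lra.
have oV' : open (set_val @^-1` V : set (circle R)) by exists V.
have cp : continuous (fun z : torus R => z i).
  exact: (@proj_continuous nat (fun=> circle R) i).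
have /continuousP cp' := cp.
exact: (cp' _ oV').
Qed.

Lemma normc_ge_Im (x : R[i]) : `|complex.Im x|%:C <= `|x|.
Proof.
rewrite -sqrtr_sqr normc_def lecR; apply: ler_wsqrtr.
by rewrite lerDr sqr_ge0.
Qed.

Lemma open_cre i (a b : R) : open [set z : torus R | a < cre i z < b].
Proof. exact: (@open_coord (@complex.Re R) i a b (@normc_ge_Re R)). Qed.

Lemma open_cim i (a b : R) : open [set z : torus R | a < cim i z < b].
Proof. exact: (@open_coord (@complex.Im R) i a b normc_ge_Im). Qed.

(** Products of rational rectangles constraining the first [size s] coordinates. The index type is
    countable, so these sets serve as a countable base. *)
Definition box (s : seq ((rat * rat) * (rat * rat))) : set (torus R) :=
  [set z | forall i, (i < size s)%N ->
     let q := nth ((0, 0), (0, 0)) s i in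
     ratr q.1.1 < cre i z < ratr q.1.2 /\ ratr q.2.1 < cim i z < ratr q.2.2].

(** If no box fits, there are points outside [O] that agree with [z] up to [n.+1%:R^-1] on the first
    [n] coordinates; they converge to [z], which contradicts openness. *)
Lemma open_box (O : set (torus R)) z : open O -> O z ->
  exists2 s, box s z & box s `<=` O.
Proof.
move=> oO Oz; apply: contrapT => nex.
have near_rat (x e : R) : 0 < e ->
    exists q : rat * rat, ratr q.1 < x < ratr q.2 /\ ratr q.2 - ratr q.1 < e.
  move=> e0; have [q /andP[q1 q2]] : exists q : rat, x - e / 2 < ratr q < x.
    have [|q] := @rat_in_itvoo R (x - e / 2) x; first by lra.
    by rewrite in_itv /=; exists q.
  have [r /andP[r1 r2]] : exists r : rat, x < ratr r < x + e / 2.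
    have [|r] := @rat_in_itvoo R x (x + e / 2); first by lra.
    by rewrite in_itv /=; exists r.
  by exists (q, r) => /=; rewrite q2 r1; split=> //; lra.
have step n (e : R) (n0 : 0 < e) : exists w, (forall i, (i < n)%N ->
    `|cre i w - cre i z| < e /\ `|cim i w - cim i z| < e) /\ ~ O w.
  have /choice[F FP] : forall i, exists q : (rat * rat) * (rat * rat),
     (ratr q.1.1 < cre i z < ratr q.1.2 /\ ratr q.1.2 - ratr q.1.1 < e) /\
     (ratr q.2.1 < cim i z < ratr q.2.2 /\ ratr q.2.2 - ratr q.2.1 < e).
    move=> i; have [q hq] := near_rat (cre i z) _ n0.
    by have [r hr] := near_rat (cim i z) _ n0; exists (q, r).
  apply: contrapT => /forallNP h; apply: nex; exists (mkseq F n) => [i|w bw].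
    by rewrite size_mkseq => ni; rewrite /= nth_mkseq //; have [[? _] [? _]] := FP i.
  apply: contrapT => nOw; apply: (h w); split => // i ni.
  have := bw i; rewrite size_mkseq => /(_ ni); rewrite /= nth_mkseq //.
  have [[/andP[a1 a2] a3] [/andP[b1 b2] b3]] := FP i.
  move=> [/andP[c1 c2] /andP[d1 d2]]; rewrite !ltr_norml.
  by split; apply/andP; split; lra.
have /choice[u uP] := fun n => step n n.+1%:R^-1 ltac:(by rewrite invr_gt0).
have : u n @[n --> \oo] --> z.
  apply: torus_seq_cvg => i; apply: circle_seq_cvg => e e0.
  have : \forall n \near \oo, n.+1%:R^-1 < e :> R.
    exact: (near_infty_natSinv_lt (PosNum e0)).
  move=> h; near=> n; have [uP1 _] := uP n.
  have [|h1 h2] := uP1 i; first by near: n; exact: nbhs_infty_gt.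
  by split; apply: (lt_trans h1) || apply: (lt_trans h2); near: n.
move=> /(_ O (open_nbhs_nbhs (conj oO Oz))) [N _ /(_ N (leqnn N))] /=.
by have [_] := uP N.
Unshelve. all: by end_near. Qed.

(** An open set is the union of the countably many boxes that it contains, and a box is a countable
    intersection of conditions on single coordinates. *)
Lemma open_sub_sigma (S : set (set (torus R))) : sigma_algebra setT S ->
  (forall i (a b : R), S [set z | a < cre i z < b]) ->
  (forall i (a b : R), S [set z | a < cim i z < b]) ->
  forall O, open O -> S O.
Proof.
move=> sS Sre Sim O oO.
have [S0 SC SU] := sS.
have ST : S setT by have := SC _ S0; rewrite setD0.
have Scap (A : nat -> set (torus R)) : (forall n, S (A n)) -> S (\bigcap_n A n).
  move=> SA; rewrite -[X in S X]setCK setC_bigcap -setTD; apply: (SC).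
  by apply: SU => n; rewrite -setTD; exact: SC.
have SI A B : S A -> S B -> S (A `&` B).
  move=> SA SB; rewrite (_ : _ `&` _ = \bigcap_n (if n is 0%N then A else B)).
    by apply: Scap => -[].
  apply/seteqP; split=> [z [Az Bz] [|n] //|z h].
  by split; [exact: (h 0%N)|exact: (h 1%N)].
have Sbox s : S (box s).
  pose q i := nth (((0, 0), (0, 0)) : (rat * rat) * (rat * rat)) s i.
  pose rect i := [set z | ratr (q i).1.1 < cre i z < ratr (q i).1.2] `&`
    [set z | ratr (q i).2.1 < cim i z < ratr (q i).2.2].
  suff -> : box s = \bigcap_i (if (i < size s)%N then rect i else setT).
    by apply: Scap => i; case: ifP => // _; apply: SI.
  apply/seteqP; split=> [z bz i _|z bz i si]; last by have := bz i I; rewrite si.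
  by case: ifPn => // /bz.
(* Boxes are listed through the encoding of the countable type; codes of no box, or of a box not
   inside [O], contribute the empty set. *)
pose B n : set (torus R) :=
  if choice.unpickle n is Some s then if `[< box s `<=` O >] then box s else set0 else set0.
suff -> : O = \bigcup_n B n.
  by apply: SU => n; rewrite /B; case: choice.unpickle => // s; case: asboolP.
apply/seteqP; split=> [z Oz|z [n _]].
  have [s bs sO] := open_box oO Oz; exists (choice.pickle s) => //.
  by rewrite /B choice.pickleK; case: asboolP.
by rewrite /B; case: choice.unpickle => // s; case: asboolP => // sO /sO.
Qed.

Let Tm := borel_torus R.

Lemma open_measurable_torus (O : set (torus R)) : open O -> measurable (O : set Tm).
Proof. by move=> oO; exact: sub_sigma_algebra. Qed.

Lemma bmeas_coord (f : torus R -> R) :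
  (forall a b : R, open [set z | a < f z < b]) ->
  (forall z, `|f z| <= 1) -> bmeas (f : Tm -> R).
Proof.
move=> of1 f1; split; last by exists 1.
apply: (measurability _ (RGenOInfty.measurableE R)).
move=> _ [_ [a ->] <-]; rewrite setTI; apply: open_measurable_torus.
(* As [f] is at most 1, the upper end 2 turns a half-line into a bounded interval. *)
suff -> : f @^-1` `]a, +oo[ = [set z | a < f z < 2] by exact: of1.
apply/seteqP; split=> z /=; rewrite in_itv /= andbT; last by case/andP.
move=> -> /=; have := f1 z; rewrite ler_norml => /andP[_ h].
by rewrite (le_lt_trans h) // ltr1n.
Qed.

Lemma bmeas_cre i : bmeas (cre i : Tm -> R).
Proof.
apply: bmeas_coord => [a b|z]; first exact: open_cre.
by have := normc_ge_Re (circle_val (z i)); rewrite norm_circle lecR.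
Qed.

Lemma bmeas_cim i : bmeas (cim i : Tm -> R).
Proof.
apply: bmeas_coord => [a b|z]; first exact: open_cim.
by have := normc_ge_Im (circle_val (z i)); rewrite norm_circle lecR.
Qed.

Lemma cbmeas_coord i : cbmeas (fun z : Tm => circle_val (z i)).
Proof. by split; [exact: bmeas_cre|exact: bmeas_cim]. Qed.

Lemma circle_valV (x : circle R) : (circle_val x)^-1 = (circle_val x)^*.
Proof.
apply: (mulfI (circle_val_neq0 x)).
by rewrite mulfV ?circle_val_neq0 // -sqr_normc norm_circle expr1n.
Qed.

Lemma cbmeas_chi q : 0 < q -> cbmeas (chi q : Tm -> R[i]).
Proof.
move=> q0; have [N [_ E]] := @chiE R q q0; 
rewrite (_ : (chi q : Tm -> R[i]) = fun z => \prod_(i < N) circle_val (z i) ^ prime_exponents q i);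
  last exact/funext/E.
apply: cbmeas_prod => i; case: prime_exponents => n; rewrite /exprz.
  exact/cbmeasX/cbmeas_coord.
under eq_fun do rewrite -exprVn circle_valV.
exact/cbmeasX/cbmeasJ/cbmeas_coord.
Qed.

(** The sets with a measurable preimage form a sigma-algebra; by [open_sub_sigma] it is enough to
    treat one coordinate, where real and imaginary parts of a product are polynomials in those of
    the factors. *)
Lemma measurable_torus_mul w :
  measurable_fun setT (torus_mul w : Tm -> Tm).
Proof.
apply: (@measurability _ _ Tm Tm _ _ (@open (torus R))) => //.
pose S := [set A : set (torus R) | measurable (torus_mul w @^-1` A : set Tm)].
have sS : sigma_algebra setT S.
  split => [|A SA|A SA]; rewrite /S /=.
  - by rewrite preimage_set0.
  - by rewrite setTD preimage_setC; exact: measurableC.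
  - by rewrite preimage_bigcup; apply: bigcup_measurable => n _; exact: SA.
move=> _ [U oU <-]; rewrite setTI.
apply: (open_sub_sigma sS) => // i a b; rewrite /S /=.
  pose g z := cre i w * cre i z - cim i w * cim i z.
  have [mg _] : bmeas (g : Tm -> R).
    by apply: bmeasB; apply: bmeasM;
      (exact: bmeas_cst || exact: bmeas_cre || exact: bmeas_cim).
  have := mg measurableT _ (measurable_itv `]a, b[); rewrite setTI.
  congr measurable; apply/seteqP; split=> z /=; by rewrite in_itv /= /cre Re_mul.
pose g z := cre i w * cim i z + cim i w * cre i z.
have [mg _] : bmeas (g : Tm -> R).
  by apply: bmeasD; apply: bmeasM; (exact: bmeas_cst || exact: bmeas_cre || exact: bmeas_cim).
have := mg measurableT _ (measurable_itv `]a, b[); rewrite setTI.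
congr measurable; apply/seteqP; split=> z /=; by rewrite in_itv /= /cim Im_mul.
Qed.

End torus_borel.

(** * Orthogonality and density of trigonometric polynomials *)

Section haar.
Variables (R : realType) (m : probability (borel_torus R) R).
Hypothesis hm : is_haar m.
Implicit Types (z w : torus R) (g h : borel_torus R -> R).

Lemma circle_val_inj : injective (@circle_val R).
Proof. by move=> x y xy; apply: val_inj. Qed.

Lemma norm_circleJ (x : circle R) : `|(circle_val x)^*| = 1.
Proof. by rewrite normcJ norm_circle. Qed.

Definition torus_inv w : torus R := fun i => Circle (norm_circleJ (w i)).

Lemma torus_mulK w : cancel (torus_mul w) (torus_mul (torus_inv w)).
Proof.
move=> z; apply/funext => i; apply: circle_val_inj.
rewrite [LHS](_ : _ = (circle_val (w i))^* * (circle_val (w i) * circle_val (z i))) //.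
by rewrite mulrA -circle_valV mulVf ?mul1r // circle_val_neq0.
Qed.

Lemma torus_mulVK w : cancel (torus_mul (torus_inv w)) (torus_mul w).
Proof.
move=> z; apply/funext => i; apply: circle_val_inj.
rewrite [LHS](_ : _ = circle_val (w i) * ((circle_val (w i))^* * circle_val (z i))) //.
by rewrite mulrA -circle_valV mulfV ?mul1r // circle_val_neq0.
Qed.

Lemma Rint_translate w g : bmeas g -> \int[m]_z g (torus_mul w z) = \int[m]_z g z.
Proof.
move=> bg; have mw := measurable_torus_mul w.
have bgw : bmeas (fun z : borel_torus R => g (torus_mul w z)).
  case: bg => mg [M gM]; split; last by exists M => z; exact: gM.
  exact: (measurableT_comp mg mw).
rewrite /Rintegral; congr fine.
have mg : measurable_fun setT (EFin \o g) by apply/measurable_EFinP; case: bg.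
have := integral_pushforward mw mg (bmeas_integrable m bgw) measurableT.
rewrite preimage_setT => <-.
(* [is_haar] speaks of images: the preimage of [A] under multiplication by [w] is its image under
   multiplication by the inverse of [w]. *)
apply: eq_measure_integral => A mA _; rewrite /= /pushforward -(hm (torus_inv w) mA).
congr (m _); apply/seteqP; split=> [z Az|_ [z Az <-]].
  by exists (torus_mul w z) => //; exact: torus_mulK.
by rewrite /= torus_mulVK.
Qed.

Lemma Cint_translate w (u : borel_torus R -> R[i]) : cbmeas u ->
  Cintegral m (fun z => u (torus_mul w z)) = Cintegral m u.
Proof.
move=> [u1 u2]; rewrite /Cintegral.
by rewrite (Rint_translate w u1) (Rint_translate w u2).
Qed.

(** Translation by [w] preserves the integral and multiplies it by [chi q w]; for [q] other than 1,
    a [w] with [chi q w != 1] forces it to vanish. *)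
Lemma Cint_chi q : 0 < q -> Cintegral m (chi q : borel_torus R -> R[i]) = (q == 1)%:R.
Proof.
move=> q0; have [->|q1] := eqVneq.
  by rewrite -[RHS](Cint_cst m); apply: eq_Cint => z; rewrite chi1.
have [w hw] := chi_neq1 R q0 q1.
have := Cint_translate w (cbmeas_chi R q0).
rewrite (eq_Cint m (fun z => chi_mul w z q0)) (CintZ _ _ (cbmeas_chi R q0)).
move/eqP; rewrite -subr_eq0 -{2}[Cintegral _ _]mul1r -mulrBl mulf_eq0.
by rewrite subr_eq0 (negbTE hw) => /eqP.
Qed.

Lemma Cint_chi_orth q r : 0 < q -> 0 < r ->
  Cintegral m (fun z => chi q z * (chi r z)^* : R[i]) = (q == r)%:R.
Proof.
move=> q0 r0; have qr0 : 0 < q / r by rewrite divr_gt0.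
have -> : (q == r) = (q / r == 1).
  by rewrite -(inj_eq (mulIf (invr_neq0 (lt0r_neq0 r0)))) divff // lt0r_neq0.
rewrite -Cint_chi //; apply: eq_Cint => z.
by rewrite chi_conj // chiM // invr_gt0.
Qed.

Lemma trig_orth (F : seq rat) (c e : rat -> R[i]) : uniq F -> {in F, forall q, 0 < q} ->
  Cintegral m (fun z => (\sum_(q <- F) c q * chi q z) *
                        (\sum_(q <- F) e q * chi q z)^*) =
  \sum_(q <- F) c q * (e q)^*.
Proof.
move=> uF F0.
(* [cbmeas_sum] wants every term of the family bounded measurable, hence a
   positive rational at every index, including those outside [F]. *)
pose p q := if q \in F then q else 1.
have p0 q : 0 < p q by rewrite /p; case: ifP => // /F0.
have pF q : q \in F -> p q = q by rewrite /p => ->.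
transitivity (Cintegral m (fun z => \sum_(q <- F) \sum_(r <- F)
   (c q * (e r)^*) * (chi (p q) z * (chi (p r) z)^*))).
  apply: eq_Cint => z; rewrite big_distrl; apply: eq_big_seq => q qF /=.
  rewrite rmorph_sum big_distrr; apply: eq_big_seq => r rF /=.
  by rewrite rmorphM !pF //; ring.
have cb q r : cbmeas (fun z : borel_torus R => chi (p q) z * (chi (p r) z)^*).
  by apply: cbmeasM; [|apply: cbmeasJ]; exact: cbmeas_chi.
have cbc q r : cbmeas (fun z : borel_torus R => (c q * (e r)^*) * (chi (p q) z * (chi (p r) z)^*)).
  by apply: cbmeasM => //; exact: cbmeas_cst.
rewrite Cint_sum; last by move=> q; exact: cbmeas_sum.
apply: eq_big_seq => q qF; rewrite Cint_sum //.
rewrite (bigD1_seq q) //= big1_seq ?addr0.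
  by rewrite CintZ // Cint_chi_orth // eqxx mulr1.
move=> r /andP[rq rF]; rewrite CintZ // Cint_chi_orth // !pF // eq_sym.
by rewrite (negbTE rq) mulr0.
Qed.

(** Real-valued trigonometric polynomials with complex coefficients. Repeated frequencies are
    allowed, so that sums are concatenations and products run over pairs; [rtrigE] collects equal
    frequencies. *)
Definition rtrig (p : borel_torus R -> R) := exists s : seq (R[i] * rat),
  (forall x, x \in s -> 0 < x.2) /\
  forall z, (p z)%:C = \sum_(x <- s) x.1 * chi x.2 z.

Lemma rtrigE p : rtrig p -> exists (F : seq rat) (c : rat -> R[i]),
  [/\ uniq F, {in F, forall q, 0 < q} &
      forall z, (p z)%:C = \sum_(q <- F) c q * chi q z].
Proof.
move=> [s [s0 ps]]; exists (undup (map snd s)).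
exists (fun q => \sum_(x <- s) if x.2 == q then x.1 else 0); split.
- exact: undup_uniq.
- by move=> q; rewrite mem_undup => /mapP[x /s0 x0 ->].
move=> z; rewrite ps.
under [RHS]eq_bigr do rewrite big_distrl /=.
rewrite exchange_big /=; apply: eq_big_seq => x xs.
rewrite (bigD1_seq x.2) ?undup_uniq ?mem_undup ?map_f //= eqxx.
by rewrite big1 ?addr0 // => q; rewrite eq_sym => /negbTE ->; rewrite mul0r.
Qed.

Lemma rtrig_bmeas p : rtrig p -> bmeas p.
Proof.
move=> /rtrigE[F [c [uF F0 pE]]].
pose P q := if q \in F then q else 1.
have p0 q : 0 < P q by rewrite /P; case: ifP => // /F0.
have [b _] : cbmeas (fun z : borel_torus R => \sum_(q <- F) c q * chi (P q) z).
  by apply: cbmeas_sum => q; apply: cbmeasM; [exact: cbmeas_cst|exact: cbmeas_chi].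
suff -> : p = fun z => complex.Re (\sum_(q <- F) c q * chi (P q) z) by [].
apply/funext => z; rewrite -[LHS]/(complex.Re (p z)%:C) pE.
by congr complex.Re; apply: eq_big_seq => q qF; rewrite /P qF.
Qed.

Lemma rtrig_cst (c : R) : rtrig (fun=> c).
Proof.
exists [:: (c%:C, 1)]; split=> [x|z]; first by rewrite inE => /eqP ->.
by rewrite big_seq1 /= chi1 mulr1.
Qed.

Lemma rtrigD g h : rtrig g -> rtrig h -> rtrig (fun z => g z + h z).
Proof.
move=> [s [s0 gs]] [t [t0 ht]]; exists (s ++ t); split=> [x|z].
  by rewrite mem_cat => /orP[/s0|/t0].
by rewrite rmorphD /= gs ht big_cat.
Qed.

Lemma rtrigM g h : rtrig g -> rtrig h -> rtrig (fun z => g z * h z).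
Proof.
move=> [s [s0 gs]] [t [t0 ht]].
exists [seq (x.1 * y.1, x.2 * y.2) | x <- s, y <- t]; split=> [x|z].
  by move=> /allpairsP[[a b] /= [/s0 a0 /t0 b0 ->]] /=; exact: mulr_gt0.
rewrite rmorphM /= gs ht big_allpairs_dep big_distrl /=.
apply: eq_big_seq => -[a u] /s0 /= u0; rewrite big_distrr.
apply: eq_big_seq => -[b v] /t0 /= v0.
by rewrite chiM // mulrACA.
Qed.

Lemma rtrig_cre i : rtrig (cre i).
Proof.
have p0 : 0 < (nth_prime i)%:R :> rat by rewrite ltr0n prime_gt0 // prime_nth_prime.
exists [:: (2^-1, (nth_prime i)%:R); (2^-1, (nth_prime i)%:R^-1)]; split=> [x|z].
  by rewrite !inE => /orP[] /eqP -> //; rewrite invr_gt0.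
rewrite big_cons big_seq1 /= -mulrDr -chi_conj // chi_prime addcJ mulKf //.
Qed.

Lemma rtrig_cim i : rtrig (cim i).
Proof.
have p0 : 0 < (nth_prime i)%:R :> rat by rewrite ltr0n prime_gt0 // prime_nth_prime.
exists [:: (- (2^-1 * 'i), (nth_prime i)%:R); (2^-1 * 'i, (nth_prime i)%:R^-1)]; split=> [x|z].
  by rewrite !inE => /orP[] /eqP -> //; rewrite invr_gt0.
rewrite big_cons big_seq1 /= mulNr addrC -mulrBr -chi_conj // chi_prime ImJ_sub.
by rewrite complexiE; ring.
Qed.

(** The bounded measurable functions in the closure of the trigonometric polynomials for the [L^2]
    norm; [e] bounds the squared distance. *)
Definition approx g := bmeas g /\ forall e : R, 0 < e ->
  exists p, rtrig p /\ \int[m]_z ((g z - p z) ^+ 2) <= e.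

Lemma approx_rtrig p : rtrig p -> approx p.
Proof.
move=> tp; split=> [|e e0]; first exact: rtrig_bmeas.
exists p; split=> //; rewrite (_ : \int[m]_z _ = 0) ?ltW //.
rewrite -[RHS](Rint_cst m); apply: eq_Rintegral => z _.
by rewrite subrr expr0n.
Qed.

Lemma approxD g h : approx g -> approx h -> approx (fun z => g z + h z).
Proof.
move=> [bg ag] [bh ah]; split=> [|e e0]; first exact: bmeasD.
have [p [tp gp]] := ag (e / 4) ltac:(by rewrite divr_gt0).
have [q [tq hq]] := ah (e / 4) ltac:(by rewrite divr_gt0).
have bp := rtrig_bmeas tp; have bq := rtrig_bmeas tq.
exists (fun z => p z + q z); split; first exact: rtrigD.
apply: le_trans (@Rint_le2 _ _ _ m _ _ _ 2 2 (bmeas_sqrB bg bp) (bmeas_sqrB bh bq) _ _) _.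
- by apply: bmeas_sqrB; exact: bmeasD.
- by move=> z; have := sqr_ge0 ((g z - p z) - (h z - q z)); nra.
- lra.
Qed.

Lemma approxM g h : approx g -> approx h -> approx (fun z => g z * h z).
Proof.
move=> [bg ag] [bh ah]; split=> [|e e0]; first exact: bmeasM.
have [_ [M hM]] := bh.
have M0 : 0 <= M by rewrite (le_trans _ (hM point)).
(* The constants come from [g * h - p * q = h * (g - p) + p * (h - q)] and
   [(x + y) ^+ 2 <= 2 * x ^+ 2 + 2 * y ^+ 2]: each term costs [e / 2]. The summand 1 keeps the
   denominators positive. *)
have a0 : 0 < 4 * (M ^+ 2 + 1) by rewrite mulr_gt0 // ltr_wpDl // sqr_ge0.
(* [q] is chosen after [p], according to the supremum [P] of [p]. *)
have [p [tp gp]] := ag (e / (4 * (M ^+ 2 + 1))) ltac:(by rewrite divr_gt0).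
have bp := rtrig_bmeas tp; have [_ [P hP]] := bp.
have P0 : 0 <= P by rewrite (le_trans _ (hP point)).
have b0 : 0 < 4 * (P ^+ 2 + 1) by rewrite mulr_gt0 // ltr_wpDl // sqr_ge0.
have [q [tq hq]] := ah (e / (4 * (P ^+ 2 + 1))) ltac:(by rewrite divr_gt0).
have bq := rtrig_bmeas tq.
exists (fun z => p z * q z); split; first exact: rtrigM.
apply: le_trans (@Rint_le2 _ _ _ m _ _ _ (2 * (M ^+ 2 + 1)) (2 * (P ^+ 2 + 1))
  (bmeas_sqrB bg bp) (bmeas_sqrB bh bq) _ _) _.
- by apply: bmeas_sqrB; exact: bmeasM.
- move=> z.
  have h2 : h z ^+ 2 <= M ^+ 2 + 1.
    by rewrite -real_normK ?num_real // ler_wpDr // ler_pXn2r ?nnegrE.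
  have p2 : p z ^+ 2 <= P ^+ 2 + 1.
    by rewrite -real_normK ?num_real // ler_wpDr // ler_pXn2r ?nnegrE.
  have -> : g z * h z - p z * q z = h z * (g z - p z) + p z * (h z - q z) by ring.
  apply: (@le_trans _ _ (2 * (h z ^+ 2 * (g z - p z) ^+ 2) + 2 * (p z ^+ 2 * (h z - q z) ^+ 2))).
    by have := sqr_ge0 (h z * (g z - p z) - p z * (h z - q z)); nra.
  by rewrite -!(mulrA 2); apply: lerD; rewrite ler_pM2l // ler_wpM2r // sqr_ge0.
- rewrite ler_pdivlMr // in gp; rewrite ler_pdivlMr // in hq; lra.
Qed.

(** By [Rint_sqr_lim] a bounded pointwise limit is also a limit in [L^2], so an approximation of one
    [g_ N] with [N] large serves for [g]. *)
Lemma approx_lim (g_ : nat -> borel_torus R -> R) g (M : R) :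
  (forall n, approx (g_ n)) -> (forall n z, `|g_ n z| <= M) ->
  (forall z, g_ n z @[n --> \oo] --> g z) -> approx g.
Proof.
move=> ag gM gg; have mg n : measurable_fun setT (g_ n) by have [[]] := ag n.
have bg := bmeas_lim mg gM gg; split=> // e e0.
have := Rint_sqr_lim m mg gM gg.
move=> /cvgrPdist_le/(_ (e / 4) ltac:(by rewrite divr_gt0))[N _ /(_ N (leqnn N))] /=.
rewrite sub0r normrN ger0_norm; last by apply: Rintegral_ge0 => z _; exact: sqr_ge0.
move=> hN; have [bN /(_ (e / 4) ltac:(by rewrite divr_gt0))[p [tp gp]]] := ag N.
have bp := rtrig_bmeas tp; exists p; split=> //.
apply: le_trans (@Rint_le2 _ _ _ m _ _ _ 2 2 (bmeas_sqrB bN bg) (bmeas_sqrB bN bp) _ _) _.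
- exact: bmeas_sqrB.
- by move=> z; have := sqr_ge0 ((g_ N z - g z) + (g_ N z - p z)); nra.
- lra.
Qed.

Lemma approx_cst (c : R) : approx (fun=> c).
Proof. exact/approx_rtrig/rtrig_cst. Qed.

Lemma approxZ (c : R) g : approx g -> approx (fun z => c * g z).
Proof. by move=> ag; apply: approxM => //; exact: approx_cst. Qed.

Lemma approxX g n : approx g -> approx (fun z => g z ^+ n).
Proof.
move=> ag; elim: n => [|n ih]; first exact: (approx_cst 1).
by under eq_fun do rewrite exprS; exact: approxM.
Qed.

Lemma eq_approx g h : g =1 h -> approx g -> approx h.
Proof. by move=> /funext ->. Qed.

(* The fixed points of this map of [-1, 1] are -1, 0 and 1, and its iterates
   converge to the sign function; they are polynomials, so an algebra closed
   under bounded limits contains the sign of each of its elements. *)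
Definition smoothstep (x : R) := (3 * x - x ^+ 3) / 2.

Lemma smoothstepN x : smoothstep (- x) = - smoothstep x.
Proof. by rewrite /smoothstep; field. Qed.

Lemma iter_smoothstepN n x : iter n smoothstep (- x) = - iter n smoothstep x.
Proof. by elim: n => //= n ->; rewrite smoothstepN. Qed.

(** The iterates [y] stay in [[x, 1]], where each step multiplies the distance to 1 by
    [1 - y * (1 + y) / 2], at most [1 - x / 2]. *)
Lemma iter_smoothstep_gt0 x n : 0 < x <= 1 ->
  x <= iter n smoothstep x <= 1 /\ 1 - iter n smoothstep x <= (1 - x / 2) ^+ n.
Proof.
move=> /andP[x0 x1]; elim: n => [|n [/andP[h1 h2] h3]] /=.
  by rewrite lexx x1 expr0; split=> //; lra.
set y := iter n smoothstep x in h1 h2 h3 *.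
have y0 : 0 < y by exact: lt_le_trans h1.
have y2 : y ^+ 2 <= 1 by rewrite expr_le1 // ltW.
split; first (apply/andP; split).
- rewrite /smoothstep; have : 0 <= y * (1 - y ^+ 2) by rewrite mulr_ge0 ?subr_ge0 // ltW.
  by rewrite mulrBr -exprS; lra.
- rewrite /smoothstep; have : 0 <= (1 - y) ^+ 2 * (2 + y) by rewrite mulr_ge0 ?sqr_ge0 //; lra.
  by rewrite (_ : _ * _ = 2 - 3 * y + y ^+ 3); [lra|ring].
rewrite exprS; apply: (@le_trans _ _ ((1 - x / 2) * (1 - y))).
  have -> : 1 - smoothstep y = (1 - y * (1 + y) / 2) * (1 - y) by rewrite /smoothstep; field.
  by apply: ler_wpM2r; [lra|nra].
by apply: ler_wpM2l => //; lra.
Qed.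

Lemma iter_smoothstep_sgr x : `|x| <= 1 -> iter n smoothstep x @[n --> \oo] --> Num.sg x.
Proof.
wlog x0 : x / 0 <= x => [hw|].
  move=> x1; have [/hw/(_ x1) //|xn] := leP 0 x.
  have := hw (- x); rewrite normrN oppr_ge0 => /(_ (ltW xn) x1) /cvgN.
  rewrite sgrN opprK; apply: cvg_trans; apply: near_eq_cvg; apply: nearW => n.
  by rewrite -[RHS]opprK -iter_smoothstepN.
rewrite ger0_norm // => x1; move: x0; rewrite le_eqVlt => /orP[/eqP <-|x0].
  rewrite sgr0; apply: cvg_near_cst; apply: nearW => n.
  by elim: n => //= n ->; rewrite /smoothstep; field.
rewrite gtr0_sg //.
have h n := @iter_smoothstep_gt0 x n; rewrite x0 x1 in h.
have g0 : (1 - x / 2) ^+ n @[n --> \oo] --> (0 : R).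
  by apply: cvg_expr; rewrite ger0_norm; lra.
apply/cvgrPdist_le => e e0; move/cvgrPdist_le: g0 => /(_ _ e0).
apply: filterS => n; rewrite sub0r normrN => /(le_trans (ler_norm _)).
have [/andP[_ a] b] := h n isT.
by rewrite ger0_norm ?subr_ge0 //; exact: le_trans.
Qed.

Lemma iter_smoothstep_le1 x n : `|x| <= 1 -> `|iter n smoothstep x| <= 1.
Proof.
wlog x0 : x / 0 <= x => [hw x1|].
  have [/hw/(_ x1) //|xn] := leP 0 x.
  by have := hw (- x); rewrite iter_smoothstepN !normrN oppr_ge0 => /(_ (ltW xn) x1).
rewrite ger0_norm // => x1; move: x0; rewrite le_eqVlt => /orP[/eqP <-|x0].
  suff -> : iter n smoothstep 0 = 0 by rewrite normr0.
  by elim: n => //= n ->; rewrite /smoothstep; field.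
have [|/andP[a b] _] := @iter_smoothstep_gt0 x n; first by rewrite x0.
by rewrite ger0_norm // (le_trans _ a) // ltW.
Qed.

Lemma approx_sgr g : approx g -> approx (fun z => Num.sg (g z)).
Proof.
move=> ag; have [[_ [M gM]] _] := ag.
have M0 : 0 <= M by rewrite (le_trans _ (gM point)).
(* Scaling by a positive constant keeps the sign and brings [g] into [[-1, 1]], where the iteration
   converges; [M + 1] is positive even if [M] is 0. *)
have c0 : 0 < (M + 1)^-1 by rewrite invr_gt0; lra.
pose h z := (M + 1)^-1 * g z.
have h1 z : `|h z| <= 1.
  by rewrite normrM gtr0_norm // mulrC ler_pdivrMr ?mul1r; [have := gM z; lra|lra].
have -> : (fun z => Num.sg (g z)) = (fun z => Num.sg (h z)).
  by apply/funext => z; rewrite /h sgrM (gtr0_sg c0) mul1r.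
apply: (@approx_lim (fun n z => iter n smoothstep (h z)) _ 1) => [n|n z|z].
- elim: n => [|n ih] /=; first exact: approxZ.
  apply: (@eq_approx (fun z => 3 / 2 * iter n smoothstep (h z) +
     (- 2^-1) * (iter n smoothstep (h z)) ^+ 3)).
    by move=> z; rewrite /smoothstep; field.
  by apply: approxD; apply: approxZ => //; exact: approxX.
- exact: iter_smoothstep_le1.
- exact: iter_smoothstep_sgr.
Qed.

(** With [s] the sign, [(s ^+ 2 + s) / 2] is 1 at 1 and 0 at 0 and -1. *)
Lemma approx_gt0 g : approx g -> approx (fun z => (0 < g z)%R%:R).
Proof.
move=> /approx_sgr ag.
apply: (@eq_approx (fun z => 2^-1 * (Num.sg (g z) ^+ 2 + Num.sg (g z)))).
  move=> z; case: (ltrgt0P (g z)) => g0.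
  - by rewrite gtr0_sg // [RHS](_ : _ = 1) //; field.
  - by rewrite ltr0_sg // [RHS](_ : _ = 0) //; field.
  - by rewrite g0 sgr0 [RHS](_ : _ = 0) //; field.
by apply: approxZ; apply: approxD => //; exact: approxX.
Qed.

Definition approx_set (A : set (torus R)) := approx (\1_A : borel_torus R -> R).

Lemma sigma_algebra_approx_set : sigma_algebra setT approx_set.
Proof.
have approxC A : approx_set A -> approx_set (~` A).
  move=> aA; apply: (@eq_approx (fun z => 1 + (-1) * \1_A z)).
    by move=> z; rewrite !indicE in_setC; case: (z \in A); rewrite /=; ring.
  by apply: approxD; [exact: approx_cst|exact: approxZ].
split=> [|A aA|A aA].
- by apply: eq_approx (approx_cst 0) => z; rewrite indic0.
- by rewrite setTD; exact: approxC.
(* The [n]-th function is the indicator of the union of the first [n] sets, written through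
   complements so that only products and sums occur. *)
apply: (@approx_lim (fun n z => 1 + (-1) * \prod_(i < n) \1_(~` A i) z) _ 1) => [n|n z|z].
- apply: approxD; first exact: approx_cst.
  apply: approxZ; elim: n => [|n ih].
    by under eq_fun do rewrite big_ord0; exact: approx_cst.
  by under eq_fun do rewrite big_ord_recr; apply: approxM => //; exact: approxC.
- have /andP[a b] : 0 <= \prod_(i < n) (\1_(~` A i) z : R) <= 1.
    elim/big_ind: _ => [|x y /andP[x0 x1] /andP[y0 y1]|i _].
    - by rewrite ler01 lexx.
    - by rewrite mulr_ge0 // mulr_ile1.
    - by rewrite indicE; case: (_ \in _); rewrite ?ler01 ?lexx.
  by rewrite ger0_norm; lra.
have [[k _ Akz]|nA] := pselect ((\bigcup_k A k) z).
  rewrite indicE mem_set; last by exists k.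
  apply: cvg_near_cst; exists k.+1 => // n /= kn.
  rewrite (bigD1 (Ordinal kn)) //= indicE in_setC mem_set //= !mul0r mulr0 addr0 //.
rewrite indicE memNset //; apply: cvg_near_cst; apply: nearW => n.
rewrite big1 ?mulr1 ?subrr // => i _; rewrite indicE mem_set // => Ai.
by apply: nA; exists (i : nat).
Qed.

Lemma approx_set_itv g (a b : R) : rtrig g -> approx_set [set z | a < g z < b].
Proof.
move=> tg; have ga : approx (fun z => g z + - a).
  by apply: approxD; [exact: approx_rtrig|exact: approx_cst].
have gb : approx (fun z => b + (-1) * g z).
  by apply: approxD; [exact: approx_cst|apply: approxZ; exact: approx_rtrig].
apply: eq_approx (approxM (approx_gt0 ga) (approx_gt0 gb)) => z.
rewrite indicE mulN1r !subr_gt0 -natrM mulnb; congr (nat_of_bool _)%:R.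
by apply/idP/idP => [h|]; rewrite ?inE.
Qed.

Lemma approx_measurable (A : set (borel_torus R)) : measurable A -> approx_set A.
Proof.
move=> mA; apply: (smallest_sub sigma_algebra_approx_set _ mA) => U oU.
apply: (open_sub_sigma sigma_algebra_approx_set) => // i a b;
  apply: approx_set_itv; [exact: rtrig_cre|exact: rtrig_cim].
Qed.

Lemma approx_sum (I : Type) (s : seq I) (g : I -> borel_torus R -> R) :
  (forall i, approx (g i)) -> approx (fun z => \sum_(i <- s) g i z).
Proof.
move=> ag; elim: s => [|i s ih].
  by under eq_fun do rewrite big_nil; exact: approx_cst.
by under eq_fun do rewrite big_cons; exact: approxD.
Qed.

Import HBNNSimple.

(** After adding [M] the function is nonnegative, hence an increasing limit of simple functions;
    these are combinations of indicators of measurable sets and stay below [M + M]. *)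
Lemma approx_bmeas g : bmeas g -> approx g.
Proof.
move=> bg; have [mg [M gM]] := bg.
have M0 : 0 <= M by rewrite (le_trans _ (gM point)).
pose f (z : borel_torus R) := (g z + M)%:E.
have mf : measurable_fun setT f.
  by apply/measurable_EFinP; apply: measurable_funD.
have f0 z : setT z -> (0 <= f z)%E.
  by move=> _; rewrite lee_fin; have := gM z; rewrite ler_norml => /andP[]; lra.
pose h n : {nnsfun borel_torus R >-> R} := nnsfun_approx measurableT mf n.
have hf z : h n z @[n --> \oo] --> g z + M.
  by have /fine_cvg := cvg_nnsfun_approx measurableT mf f0 (I : setT z).
have ndh z : nondecreasing_seq (fun n => h n z).
  by move=> a b ab; have /lefP := nd_nnsfun_approx measurableT mf ab.
apply: (@eq_approx (fun z => (g z + M) + - M)); first by move=> z; rewrite addrK.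
apply: approxD; last exact: approx_cst.
apply: (@approx_lim (fun n z => h n z) _ (M + M)) => // [n|n z].
  apply: (@eq_approx (fun z => \sum_(i < size (finmap.enum_fset (fset_set (range (h n)))))
    (finmap.enum_fset (fset_set (range (h n))))`_i *
     \1_(h n @^-1` [set (finmap.enum_fset (fset_set (range (h n))))`_i]) z)).
    by move=> z; rewrite [RHS]fimfunEord.
  apply: approx_sum => i; apply: approxZ; exact: approx_measurable.
rewrite ger0_norm; last exact: fun_ge0.
apply: (@le_trans _ _ (g z + M)); last by rewrite lerD2r (le_trans (ler_norm _)).
rewrite -(cvg_lim _ (hf z)) //; apply: nondecreasing_cvgn_le => //.
by apply/cvg_ex; exists (g z + M).
Qed.

End haar.

(** * Parseval's identity and quotients of Folner sets *)

Section parseval.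
Variables (R : realType) (m : probability (borel_torus R) R).
Hypothesis hm : is_haar m.

Definition sqn (x : R[i]) : R := complex.Re x ^+ 2 + complex.Im x ^+ 2.

Lemma sqn_ge0 x : 0 <= sqn x.
Proof. by rewrite addr_ge0 // sqr_ge0. Qed.

Lemma sqnE x : (sqn x)%:C = x * x^*.
Proof. by rewrite add_Re2_Im2 sqr_normc. Qed.

(** For [p] with coefficients [c] on [F] and [f] the coefficients of [g], [\int (g - p)^2 = \int g^2
    - \sum |f|^2 + \sum |f - c|^2], with sums over [F]; density provides a [p] for which the left
    side is at most [e]. *)
Lemma parseval_lower (g : borel_torus R -> R) (e : R) : bmeas g -> 0 < e ->
  exists F : seq rat, [/\ uniq F, {in F, forall q, 0 < q} &
    \int[m]_z (g z ^+ 2) - e <=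
      \sum_(q <- F) sqn (fourier_coef m (fun z => (g z)%:C) q)].
Proof.
move=> bg e0; have [_ /(_ e e0)[p [tp hp]]] := approx_bmeas m bg.
have bp := rtrig_bmeas tp; have [F [c [uF F0 pE]]] := rtrigE tp.
exists F; split=> //.
set f := fourier_coef m _.
have fE q : f q = Cintegral m (fun z => (g z)%:C * (chi q z)^*) by [].
clearbody f.
pose P q := if q \in F then q else 1.
have P0 q : 0 < P q by rewrite /P; case: ifP => // /F0.
have PF q : q \in F -> P q = q by rewrite /P => ->.
have gp : (\int[m]_z (g z * p z))%:C = \sum_(q <- F) (c q)^* * f q.
  rewrite -Cint_real (@eq_Cint _ _ _ _ _ (fun z =>
      \sum_(q <- F) (c q)^* * ((g z)%:C * (chi (P q) z)^*))); last first.
    move=> z; have -> : (g z * p z)%:C = (g z)%:C * ((p z)%:C)^* by rewrite conjc_real -rmorphM.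
    rewrite pE rmorph_sum big_distrr /=.
    by apply: eq_big_seq => q qF; rewrite PF // rmorphM /= mulrCA mulrA.
  have cb q : cbmeas (fun z : borel_torus R => (g z)%:C * (chi (P q) z)^*).
    by apply: cbmeasM; [exact: cbmeas_real|apply: cbmeasJ; exact: cbmeas_chi].
  rewrite Cint_sum; last by move=> q; apply: cbmeasM => //; exact: cbmeas_cst.
  by apply: eq_big_seq => q qF; rewrite CintZ // fE PF.
have pp : (\int[m]_z (p z ^+ 2))%:C = (\sum_(q <- F) sqn (c q))%:C.
  rewrite -Cint_real rmorph_sum /=.
  under [RHS]eq_bigr do rewrite sqnE.
  rewrite -(trig_orth hm c c uF F0); apply: eq_Cint => z.
  by rewrite -pE conjc_real -rmorphM -expr2.
move/complexI: pp => pp.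
have {}gp : \int[m]_z (g z * p z) = \sum_(q <- F)
    (complex.Re (c q) * complex.Re (f q) + complex.Im (c q) * complex.Im (f q)).
  rewrite -[LHS]/(complex.Re _%:C) gp raddf_sum /=; apply: eq_bigr => q _.
  by rewrite Re_mul Re_conjc Im_conjc mulNr opprK.
have bgp : bmeas (fun z => g z * p z) by exact: bmeasM.
have E : \int[m]_z ((g z - p z) ^+ 2) =
    \int[m]_z (g z ^+ 2) + (-2) * \int[m]_z (g z * p z) + \int[m]_z (p z ^+ 2).
  rewrite -RintZ // -RintD; [|exact: bmeasX|exact: bmeasZ].
  rewrite -RintD; [|apply: bmeasD; [exact: bmeasX|exact: bmeasZ]|exact: bmeasX].
  by apply: eq_Rintegral => z _; ring.
rewrite E gp pp in hp.
suff : 0 <= \sum_(q <- F) sqn (f q) - 2 * (\sum_(q <- F)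
  (complex.Re (c q) * complex.Re (f q) + complex.Im (c q) * complex.Im (f q)))
  + \sum_(q <- F) sqn (c q) by lra.
rewrite big_distrr -sumrB -big_split /=; apply: sumr_ge0 => q _.
apply: (@le_trans _ _ (sqn (f q - c q))); first exact: sqn_ge0.
rewrite /sqn !raddfB /=; lra.
Qed.

End parseval.

(** * Pairs of a Folner set with a given quotient *)

Section folner.
Variable R : realType.

Definition quot_count (s : seq nat) (q : rat) : nat :=
  (\sum_(x <- s) \sum_(y <- s) (x%:R / y%:R == q))%N.

(* Each [l] in [s] with [a * l] and [b * l] in [s] gives the pair
   [(a * l, b * l)], of quotient [a / b]. *)
Lemma quot_count_ge (s : seq nat) (a b : nat) : uniq s ->
  {in s, forall x, (0 < x)%N} -> (0 < b)%N ->
  (count [pred x | (a * x)%N \in s] s + count [pred x | (b * x)%N \in s] s <=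
   quot_count s (a%:R / b%:R) + size s)%N.
Proof.
move=> us s0 b0.
have h : (\sum_(l <- s) ((a * l)%N \in s) * ((b * l)%N \in s) <= quot_count s (a%:R / b%:R))%N.
  apply: (@leq_trans (\sum_(x <- s) \sum_(y <- s) \sum_(l <- s)
    ((a * l == x) && (b * l == y)%N))%N).
    rewrite -(eq_bigr _ (fun x _ => exchange_big _ _ _ _ _ _)) exchange_big /=.
    rewrite big_seq [leqRHS]big_seq; apply: leq_sum => l ls.
    case: (boolP (_ \in _)) => //= al; case: (boolP (_ \in _)) => //= bl.
    by rewrite (bigD1_seq (a * l)%N) //= (bigD1_seq (b * l)%N) //= !eqxx.
  rewrite /quot_count big_seq [leqRHS]big_seq; apply: leq_sum => x xs.
  rewrite big_seq [leqRHS]big_seq; apply: leq_sum => y ys.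
  have [/hasP[l ls /andP[/eqP lx /eqP ly]]|/hasPn nl] :=
      boolP (has (fun l => (a * l == x) && (b * l == y))%N s); last first.
    by rewrite big1_seq // => l /andP[_ /nl /negbTE ->].
  have l0 := s0 _ ls.
  rewrite (bigD1_seq l) //= big1_seq => [|k /andP[kl _]]; last first.
    apply/eqP; rewrite eqb0; apply: contra kl => /andP[_ /eqP].
    by rewrite -ly => /eqP; rewrite eqn_pmul2l.
  rewrite lx ly !eqxx addn0 /= -lx -ly !natrM -mulf_div divff ?mulr1 ?eqxx //.
  by rewrite pnatr_eq0 -lt0n.
apply: leq_trans (leq_add h (leqnn _)).
rewrite -!sum1_count -sum1_size big_mkcond [X in (_ + X <= _)%N]big_mkcond.
rewrite -!big_split /=.
by apply: leq_sum => l _; case: (_ \in _); case: (_ \in _).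
Qed.

Variable sigma : nat -> {fset nat}.
Hypothesis hsigma : multiplicative_folner R sigma.

(** The Folner property for the numerator and for the denominator gives two subsets missing at most
    a fraction [e / 2] each; [quot_count_ge] draws the pairs from their intersection. *)
Lemma folner_quot_count (q : rat) (e : R) : 0 < q -> 0 < e ->
  \forall N \near \oo, (1 - e) * (#|` sigma N|)%:R <= (quot_count (sigma N) q)%:R :> R.
Proof.
move=> /pos_ratP[a [b [a0 b0 ->]]] e0; have [s0 s1 s2] := hsigma.
have step c : (0 < c)%N -> \forall N \near \oo,
    (1 - e / 2) * (#|` sigma N|)%:R <= (count [pred x | (c * x)%N \in sigma N] (sigma N))%:R :> R.
  move=> c0; have /cvgrPdist_le/(_ (e / 2) ltac:(by rewrite divr_gt0)) := s2 c c0.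
  apply: filterS => N; have sN : 0 < (#|` sigma N|)%:R :> R by rewrite ltr0n cardfs_gt0.
  have -> : #|` [fset k in sigma N | (c * k)%N \in sigma N]%fset| =
      count [pred x | (c * x)%N \in sigma N] (sigma N).
    rewrite card_fset_sum1 -sum1_count; rewrite [RHS]big_fset_condE /=.
    by apply: eq_fbigl => k; rewrite !inE.
  move=> /(le_trans (ler_norm _)) h.
  by rewrite -ler_pdivlMr //; lra.
near=> N.
have ha : (1 - e / 2) * (#|` sigma N|)%:R <=
  (count [pred x | (a * x)%N \in sigma N] (sigma N))%:R :> R by near: N; exact: step.
have hb : (1 - e / 2) * (#|` sigma N|)%:R <=
  (count [pred x | (b * x)%N \in sigma N] (sigma N))%:R :> R by near: N; exact: step.
have := @quot_count_ge (sigma N) a b (fset_uniq _) (s1 N) b0.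
rewrite -(ler_nat R) !natrD; lra.
Unshelve. all: by end_near. Qed.

End folner.

(** * Spectra of Toeplitz matrices *)

Lemma mxtrace_conj_sqr (K : comUnitRingType) n (S D : 'M[K]_n) : S \in unitmx ->
  \tr (D *m D) = \tr (invmx S *m D *m S *m (invmx S *m D *m S)).
Proof.
move=> Su; rewrite [RHS]mxtrace_mulC !mulmxA mulmxK // mxtrace_mulC !mulmxA mulmxV //.
by rewrite mul1mx.
Qed.

Section toeplitz_spectrum.
Variables (R : realType) (m : probability (borel_torus R) R).
Hypothesis hm : is_haar m.
Variables (s : {fset nat}).
Hypothesis s_gt0 : forall k, k \in s -> (0 < k)%N.

Local Notation n := #|` s|.
Local Notation node a := ((nth 0%N s (a : 'I_n))%:R : rat).
Local Notation "M ^t*" := (map_mx (@Num.conj _) (M^T)).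

Lemma node_gt0 (a : 'I_n) : 0 < node a.
Proof. by rewrite ltr0n s_gt0 // mem_nth. Qed.

Lemma node_div_eq1 (a b : 'I_n) : (node a / node b == 1) = (a == b).
Proof.
rewrite -[X in _ == X](@divff _ (node b)) ?lt0r_neq0 ?node_gt0 //.
rewrite (inj_eq (mulIf (invr_neq0 (lt0r_neq0 (node_gt0 b))))) eqr_nat.
by rewrite nth_uniq // fset_uniq.
Qed.

(** The character of a quotient is that of the numerator times the conjugate of that of the
    denominator: the entry is the inner product of [g * chi (node b)] with [chi (node a)], as for a
    compression of multiplication by [g]. *)
Lemma toeplitzE (g : borel_torus R -> R) a b :
  toeplitz m (fun z => (g z)%:C) s a b =
  Cintegral m (fun z => (g z)%:C * ((chi (node a) z)^* * chi (node b) z)).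
Proof.
rewrite mxE; apply: eq_Cint => z.
rewrite -[RHS]/((g z)%:C * ((chi (node a) z)^* * chi (node b) z)).
rewrite -[X in _ = _ * (_ * X)]conjcK -rmorphM (chi_conj z (node_gt0 b)).
by rewrite -chiM ?invr_gt0 ?node_gt0.
Qed.

Lemma toeplitz_conj g a b : bmeas g ->
  toeplitz m (fun z => (g z)%:C) s b a = (toeplitz m (fun z => (g z)%:C) s a b)^*.
Proof.
move=> bg; rewrite !toeplitzE -CintJ; last first.
  apply: cbmeasM; first exact: cbmeas_real.
  by apply: cbmeasM; [apply: cbmeasJ|]; apply: cbmeas_chi; exact: node_gt0.
by apply: eq_Cint => z; rewrite !rmorphM /= conjcK oppr0 [X in _ * X]mulrC.
Qed.

Lemma toeplitz1 : toeplitz m (fun=> 1%:C) s = 1%:M.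
Proof.
apply/matrixP => a b; rewrite (toeplitzE (fun=> 1)) [RHS]mxE.
rewrite -node_div_eq1 -(inj_eq (mulIf (lt0r_neq0 (node_gt0 b)))).
rewrite mul1r divfK ?lt0r_neq0 ?node_gt0 // eq_sym.
rewrite -(Cint_chi_orth hm (node_gt0 b) (node_gt0 a)).
by apply: eq_Cint => z; rewrite mul1r mulrC.
Qed.

(* For [S = spectralmx A], whose rows are the conjugates of the eigenvectors of
   [A], [wave S i] is the i-th eigenvector seen as a function on the torus. *)
Definition wave (S : 'M[R[i]]_n) (i : 'I_n) (z : torus R) : R[i] :=
  \sum_a (S i a)^* * chi (node a) z.

Lemma cbmeas_wave S i : cbmeas (wave S i : borel_torus R -> R[i]).
Proof.
apply: cbmeas_sum => a; apply: cbmeasM; first exact: cbmeas_cst.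
exact/cbmeas_chi/node_gt0.
Qed.

Lemma bmeas_sqn_wave S i : bmeas (fun z : borel_torus R => sqn (wave S i z)).
Proof. by have [b1 b2] := cbmeas_wave S i; apply: bmeasD; exact: bmeasX. Qed.

Lemma sqn_waveE S i z : (sqn (wave S i z))%:C =
  \sum_a \sum_b (S i a * (S i b)^*) * ((chi (node a) z)^* * chi (node b) z).
Proof.
rewrite sqnE /wave rmorph_sum big_distrr /=; apply: eq_bigr => a _.
rewrite big_distrl /=; apply: eq_bigr => b _.
by rewrite rmorphM /= conjcK; ring.
Qed.

(** When [S] diagonalises the matrix of [g] this is the eigenvalue; for [g = 1] it is the squared
    norm of the wave. *)
Lemma toeplitz_quad S (g : borel_torus R -> R) i : bmeas g ->
  (\int[m]_z (g z * sqn (wave S i z)))%:C =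
  (S *m toeplitz m (fun z => (g z)%:C) s *m S^t*) i i.
Proof.
move=> bg; have bgC := cbmeas_real bg.
have bk a b : cbmeas (fun z : borel_torus R =>
    (g z)%:C * ((chi (node a) z)^* * chi (node b) z)).
  by do 2 apply: cbmeasM => //; [apply: cbmeasJ|]; apply: cbmeas_chi; exact: node_gt0.
rewrite -Cint_real (@eq_Cint _ _ _ _ _ (fun z => \sum_a \sum_b (S i a * (S i b)^*) *
  ((g z)%:C * ((chi (node a) z)^* * chi (node b) z)))); last first.
  move=> z; transitivity ((g z)%:C * (sqn (wave S i z))%:C); first exact: rmorphM.
  rewrite sqn_waveE big_distrr; apply: eq_bigr => a _.
  by rewrite big_distrr; apply: eq_bigr => b _; exact: mulrCA.
have bk' a b : cbmeas (fun z : borel_torus R => (S i a * (S i b)^*) *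
    ((g z)%:C * ((chi (node a) z)^* * chi (node b) z))).
  by apply: cbmeasM => //; exact: cbmeas_cst.
rewrite Cint_sum; last by move=> a; exact: cbmeas_sum.
rewrite mxE; under [RHS]eq_bigr do rewrite mxE big_distrl.
rewrite [RHS]exchange_big; apply: eq_bigr => a _.
rewrite Cint_sum //; apply: eq_bigr => b _.
rewrite CintZ // -toeplitzE (_ : S^t* b i = (S i b)^*); last by rewrite !mxE.
exact: mulrAC.
Qed.

(** Orthonormality of the columns of [S] removes the cross terms, and each diagonal term is
    [|chi|^2 = 1], at every point [z] and not only on average. *)
Lemma sum_sqn_wave S z : S^t* *m S = 1%:M -> \sum_i sqn (wave S i z) = n%:R.
Proof.
move=> SS; apply: complexI; rewrite rmorph_sum /=.
under eq_bigr do rewrite sqn_waveE.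
rewrite exchange_big /=.
under eq_bigr do rewrite exchange_big /=.
have E a b : \sum_i (S i a * (S i b)^*) = (a == b)%:R.
  have /matrixP/(_ b a) := SS; rewrite !mxE eq_sym => <-.
  by apply: eq_bigr => i _; rewrite !mxE mulrC.
transitivity (\sum_(a < n) (1 : R[i])); last by rewrite sumr_const card_ord rmorph_nat.
apply: eq_bigr => a _; under eq_bigr do rewrite -big_distrl E.
rewrite (bigD1 a) //= eqxx mul1r mulrC chi_mulJ ?node_gt0 // big1 ?addr0 //.
by move=> b ba; rewrite eq_sym (negbTE ba) mul0r.
Qed.

(** [lam] and [w] do not depend on [f], so the same data serve the real and the imaginary part of a
    test function. The sum of squares is the trace of the squared matrix, which for a Hermitian
    matrix is the sum of the squared moduli of its entries. *)
Lemma toeplitz_spectrum (g : borel_torus R -> R) : bmeas g ->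
  exists (lam : 'I_n -> R) (w : 'I_n -> borel_torus R -> R),
  [/\ forall i, bmeas (w i) /\ (forall z, 0 <= w i z),
      forall z, \sum_i w i z = n%:R,
      forall i, \int[m]_z w i z = 1 /\ \int[m]_z (g z * w i z) = lam i,
      \sum_i lam i ^+ 2 =
        (\sum_a \sum_b sqn (toeplitz m (fun z => (g z)%:C) s a b))%R &
      forall f : R -> R[i],
        \tr (hermitian_fun f (toeplitz m (fun z => (g z)%:C) s)) = \sum_i f (lam i)].
Proof.
move=> bg; set A := toeplitz _ _ _.
have AJ a b : A b a = (A a b)^* by exact: toeplitz_conj.
have Aquad S i : (\int[m]_z (g z * sqn (wave S i z)))%:C = (S *m A *m S^t*) i i.
  exact: toeplitz_quad.
clearbody A.
have Anormal : A \is normalmx.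
  apply/normalmxP; have -> // : A^t* = A.
  by apply/matrixP => a b; rewrite !mxE [RHS]AJ.
pose S := spectralmx A; pose D := spectral_diag A.
have uS : S \is unitarymx := spectral_unitarymx A.
have Su : S \in unitmx := spectral_unit A.
have SV : invmx S = S^t* := invmx_unitary uS.
have AE : A = invmx S *m diag_mx D *m S  by apply/orthomx_spectralP.
have trE (f : R -> R[i]) : \tr (hermitian_fun f A) =
    \tr (invmx S *m diag_mx (map_mx (fun x => f (complex.Re x)) D) *m S) by [].
clearbody S D.
have DE i : (\int[m]_z (g z * sqn (wave S i z)))%:C = D 0 i.
  rewrite Aquad -SV [in LHS]AE !mulmxA mulmxV // mul1mx mulmxK //.
  by rewrite mxE eqxx mulr1n.
exists (fun i => \int[m]_z (g z * sqn (wave S i z))), (fun i z => sqn (wave S i z)).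
split.
- by move=> i; split; [exact: bmeas_sqn_wave|move=> z; exact: sqn_ge0].
- by move=> z; apply: sum_sqn_wave; rewrite -SV mulVmx.
- move=> i; split=> //; apply: complexI.
  have := toeplitz_quad S i (@bmeas_cst _ (borel_torus R) R 1).
  rewrite toeplitz1 mulmx1 -SV mulmxV // mxE eqxx => h1; apply: etrans h1.
  by congr (_%:C); apply: eq_Rintegral => z _; rewrite mul1r.
- apply: complexI; rewrite rmorph_sum /=.
  transitivity (\tr (diag_mx D *m diag_mx D)).
    rewrite /mxtrace; apply: eq_bigr => i _; rewrite rmorphXn /= DE.
    by rewrite mul_diag_mx !mxE eqxx mulr1n expr2.
  transitivity (\tr (A *m A)).
    by rewrite AE; exact: mxtrace_conj_sqr.
  rewrite /mxtrace rmorph_sum; apply: eq_bigr => a _; rewrite mxE rmorph_sum.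
  by apply: eq_bigr => b _; rewrite (AJ a b); exact/esym/sqnE.
- move=> f; rewrite trE mxtrace_mulC mulmxA mulmxV // mul1mx.
  rewrite mxtrace_diag; apply: eq_bigr => i _; rewrite !mxE.
  by rewrite -DE.
Qed.

End toeplitz_spectrum.

(** * Averaging against the spectral weights *)

Section trace_estimate.
Context d (T : measurableType d) (R : realType) (m : probability T R).

(* [\int w i = 1] and [\int g * w i = lam i] turn [\int (g - lam i) ^+ 2 * w i]
   into [\int g ^+ 2 * w i - lam i ^+ 2]. *)
Lemma Rint_weighted_le (I : finType) (g h : T -> R) (w : I -> T -> R)
    (lam c : I -> R) (e C : R) :
  bmeas g -> bmeas h -> (forall i, bmeas (w i) /\ (forall x, 0 <= w i x)) ->
  (forall x, \sum_i w i x = #|I|%:R) ->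
  (forall i, \int[m]_x w i x = 1 /\ \int[m]_x (g x * w i x) = lam i) ->
  (forall i x, h x <= c i + e + C * (g x - lam i) ^+ 2) ->
  #|I|%:R * \int[m]_x h x <=
    \sum_i c i + e * #|I|%:R + C * (#|I|%:R * \int[m]_x (g x ^+ 2) - \sum_i lam i ^+ 2).
Proof.
move=> bg bh bw wn wlam hle.
(* The weights add up to [#|I|] at each point, so an integral splits into integrals against the
   [w i]. *)
have sumw (k : T -> R) : bmeas k ->
    #|I|%:R * \int[m]_x k x = \sum_i \int[m]_x (k x * w i x).
  move=> bk; rewrite -RintZ // -Rint_sum; last by move=> i; apply: bmeasM => //; have [] := bw i.
  by apply: eq_Rintegral => x _; rewrite -big_distrr /= wn mulrC.
have bg2 : bmeas (fun x => g x ^+ 2) by exact: bmeasX.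
have -> : e * #|I|%:R = \sum_(i : I) e by rewrite sumr_const mulr_natr.
rewrite (sumw h) // (sumw (fun x => g x ^+ 2)) // -sumrB mulr_sumr -!big_split /=.
apply: ler_sum => i _.
have [bwi wi0] := bw i; have [w1 wl] := wlam i.
have b2 : bmeas (fun x => g x ^+ 2 * w i x) by exact: bmeasM.
have b1 : bmeas (fun x => g x * w i x) by exact: bmeasM.
(* The bound times [w i], expanded in [g ^+ 2 * w i], [g * w i] and [w i]: the integrals of the last
   two are known, that of the first is kept. *)
pose k x := C * (g x ^+ 2 * w i x) + ((- 2 * C * lam i) * (g x * w i x) +
  (c i + e + C * lam i ^+ 2) * w i x).
have bk : bmeas k by apply: bmeasD; [|apply: bmeasD]; exact: bmeasZ.
apply: (@le_trans _ _ (\int[m]_x k x)).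
  apply: Rint_le => //; first exact: bmeasM.
  move=> x; have := ler_wpM2r (wi0 x) (hle i x); rewrite /k; lra.
rewrite RintD; [|exact: bmeasZ|by apply: bmeasD; exact: bmeasZ].
rewrite RintD ?RintZ //; [|exact: bmeasZ|exact: bmeasZ].
by rewrite w1 wl; lra.
Qed.

End trace_estimate.

(** * Almost everywhere bounds *)

(* Uniform continuity where [x] and [y] are close; elsewhere the oscillation of
   [f] is absorbed by [C * (x - y) ^+ 2]. *)
Lemma quadratic_modulus (R : realType) (f : R -> R) (a b e : R) :
  a <= b -> continuous f -> 0 < e ->
  exists2 C, 0 <= C & forall x y, x \in `[a, b] -> y \in `[a, b] ->
    `|f x - f y| <= e + C * (x - y) ^+ 2.
Proof.
move=> ab cf e0.
have cfw : {within `[a, b], continuous f} by exact: continuous_subspaceT.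
have [c1 _ fc1] := EVT_max ab cfw; have [c2 _ fc2] := EVT_min ab cfw.
pose K := f c1 - f c2.
have fK x y : x \in `[a, b] -> y \in `[a, b] -> `|f x - f y| <= K.
  move=> xab yab; have := fc1 x xab; have := fc1 y yab; have := fc2 x xab.
  by have := fc2 y yab; rewrite /K ler_norml => *; apply/andP; split; lra.
have K0 : 0 <= K by rewrite (le_trans _ (fK a a _ _)) ?in_itv /= ?lexx.
(* Compactness of the interval turns constants valid near each [x0] into a single one: the property
   is proved for all large [C]. *)
have /compact_near_coveringP cov := @segment_compact R a b.
have /= := cov R +oo (fun C x => forall y, y \in `[a, b] -> x \in `[a, b] ->
  `|f x - f y| <= e + C * (x - y) ^+ 2) _.
case=> [x0 _|N [Nr hN]]; last first.
  exists (Num.max (N + 1) 0); first by rewrite le_max lexx orbT.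
  move=> x y xab yab; apply: (hN (Num.max (N + 1) 0)) => //.
    by rewrite lt_max ltrDl ltr01.
have /cvgrPdist_lt/(_ (e / 2) ltac:(by rewrite divr_gt0)) := cf x0.
move=> /nbhs_ballP[d /= d0 hd].
have d2 : 0 < d / 2 by rewrite divr_gt0.
have d20 : 0 < (d / 2) ^+ 2 by rewrite exprn_gt0.
(* With [x] within [d / 2] of [x0]: if [y] is within [d], both values are within [e / 2] of [f x0];
   otherwise [x] and [y] are at least [d / 2] apart and the quadratic term is at least [K]. *)
exists (ball x0 (d / 2), [set C | K / (d / 2) ^+ 2 <= C]) => /=.
  split; first exact: nbhsx_ballx.
  by apply: nbhs_pinfty_ge; exact: num_real.
move=> [x C] /= [xx0 KC] y yab xab.
have C0 : 0 <= C by apply: le_trans KC; rewrite divr_ge0 // ltW.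
have [yd|yd] := ltP `|x0 - y| d.
  have h1 : `|f x0 - f y| < e / 2 by apply: hd.
  have h2 : `|f x0 - f x| < e / 2.
    apply: hd; rewrite -ball_normE /= in xx0 *; apply: lt_trans xx0 _; lra.
  have : 0 <= C * (x - y) ^+ 2 by rewrite mulr_ge0 ?sqr_ge0.
  suff : `|f x - f y| <= e by lra.
  rewrite (_ : f x - f y = (f x0 - f y) - (f x0 - f x)); last by ring.
  by rewrite (le_trans (ler_normB _ _)) //; lra.
rewrite -ball_normE /= in xx0.
have xy : d / 2 <= `|x - y|.
  have := ler_normD (x0 - x) (x - y); rewrite (_ : x0 - x + (x - y) = x0 - y); last by ring.
  lra.
have xy2 : (d / 2) ^+ 2 <= (x - y) ^+ 2.
  by rewrite -[leRHS]real_normK ?num_real // ler_pXn2r ?nnegrE // ltW.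
apply: le_trans (fK x y xab yab) _; apply: ler_wpDl; first exact: ltW.
apply: (@le_trans _ _ (C * (d / 2) ^+ 2)); last exact: ler_wpM2l.
by rewrite -ler_pdivrMr.
Qed.

Section ae_integral.
Context d (T : measurableType d) (R : realType) (m : {measure set T -> \bar R}).
Import HBNNSimple.

(* [f] need not be measurable, which [ae_eq_integral] would require: the function
   of the theorem is arbitrary off the essential range of [phi]. *)
Lemma ge0_integral_eq_off (f g : T -> \bar R) (N : set T) : measurable N -> m N = 0 ->
  measurable_fun setT g -> (forall x, 0 <= f x)%E -> (forall x, 0 <= g x)%E ->
  (forall x, ~ N x -> f x = g x) -> (\int[m]_x f x = \int[m]_x g x)%E.
Proof.
move=> mN N0 mg f0 g0 fg; apply/eqP; rewrite eq_le; apply/andP; split.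
  (* A simple function below [f] is below [g] almost everywhere, which bounds the supremum defining
     the integral of [f]. *)
  rewrite ge0_integralTE //; apply: ge_ereal_sup => _ [h hf <-].
  rewrite -integralT_nnsfun; apply: ae_ge0_le_integral => //.
  - by move=> x _; rewrite lee_fin.
  - by apply/measurable_EFinP.
  - exists N; split=> // x /= hx; apply: contrapT => Nx; apply: hx => _.
    by rewrite -fg.
have mC := measurableC mN.
(* Conversely, [g] cut to 0 on [N] has the same integral as [g] and lies below [f] everywhere. *)
rewrite (ge0_negligible_integral mN) // setTD integral_mkcond.
rewrite !ge0_integralTE //; last by move=> x; rewrite erestrict_ge0.
apply: le_ereal_sup => _ [h hg <-]; exists h => //= x.
apply: le_trans (hg x) _; rewrite patchE; case: ifPn => // /set_mem Nx.
by rewrite fg.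
Qed.

Lemma Rintegral_eq_off (f g : T -> R) (N : set T) : measurable N -> m N = 0 ->
  measurable_fun setT g -> (forall x, ~ N x -> f x = g x) ->
  \int[m]_x f x = \int[m]_x g x.
Proof.
move=> mN N0 /measurable_EFinP mg fg; rewrite /Rintegral; congr fine.
rewrite integralE [RHS]integralE; congr (_ - _)%E;
  apply: (ge0_integral_eq_off mN) => // [|x /fg fgx].
- exact: measurable_funepos.
- by rewrite !funeposE fgx.
- exact: measurable_funeneg.
- by rewrite !funenegE fgx.
Qed.

End ae_integral.

Section essential_bounds.
Context d (T : measurableType d) (R : realType) (m : probability T R).

(** An almost everywhere bound [M] on the absolute value places both essential bounds in [[- M, M]],
    so they are finite. *)
Lemma Lfun_infty_bounds (phi : T -> R) : phi \in Lfun m +oo%E ->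
  exists a b : R, [/\ a <= b, measurable_fun setT phi,
    ess_inf m (EFin \o phi) = a%:E, ess_sup m (EFin \o phi) = b%:E &
    exists N : set T, [/\ measurable N, m N = 0 &
      forall x, ~ N x -> a <= phi x <= b]].
Proof.
rewrite inE/= => /andP[/[1!inE]/= mphi] /[!inE]/= fin.
have m0 : (0 < m setT)%E by have := probability_setT m => /= ->; rewrite lte01.
have [M hM] : exists M, \forall x \ae m, `|phi x| <= M.
  apply: (@ess_supr_bounded _ _ _ _ (fun x => `|phi x|)).
  move: fin; rewrite /finite_norm /= unlock /Lnorm m0.
  by [].
have sup_le : (ess_sup m (EFin \o phi) <= M%:E)%E.
  by apply/ess_supP; apply: filterS hM => x; rewrite /= lee_fin ler_norml => /andP[].
have inf_ge : ((- M)%:E <= ess_inf m (EFin \o phi))%E.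
  by apply/ess_infP; apply: filterS hM => x; rewrite /= lee_fin ler_norml => /andP[].
have inf_sup : (ess_inf m (EFin \o phi) <= ess_sup m (EFin \o phi))%E.
  by apply: ess_sup_gee => //; exact: ess_inf_le.
have fi : ess_inf m (EFin \o phi) \is a fin_num.
  rewrite fin_numE -ltNye -ltey (lt_le_trans (ltNyr (- M)) inf_ge) /=.
  by rewrite (le_lt_trans inf_sup) // (le_lt_trans sup_le) // ltry.
have fs : ess_sup m (EFin \o phi) \is a fin_num.
  rewrite fin_numE -ltNye -ltey (le_lt_trans sup_le) ?ltry // andbT.
  by rewrite (lt_le_trans _ inf_sup) // (lt_le_trans (ltNyr (- M)) inf_ge).
exists (fine (ess_inf m (EFin \o phi))), (fine (ess_sup m (EFin \o phi))).
split; rewrite ?fineK //; first by rewrite fine_le.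
have := ess_inf_le m (EFin \o phi) ; have := ess_sup_ge m (EFin \o phi).
move=> h1 h2; have [N [mN N0 hN]] := filterI h1 h2.
exists N; split=> // x Nx; have : ~ ~ (((EFin \o phi) x <= ess_sup m (EFin \o phi))%E /\
   (ess_inf m (EFin \o phi) <= (EFin \o phi) x)%E).
  by move=> h; apply: Nx; apply: hN.
by move=> /contrapT[h3 h4]; rewrite -!lee_fin !fineK // h3 h4.
Qed.

End essential_bounds.

(** * Averages over the spectrum *)

Section clamp.
Variables (R : realType) (a b : R).
Hypothesis ab : a <= b.

(** Nearest-point projection onto [[a, b]]. Applied to [phi] it gives a function bounded everywhere
    and equal to [phi] almost everywhere; precomposed to [f] it extends continuity from the interval
    to the line. *)
Definition clamp (x : R) := Num.max a (Num.min b x).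

Lemma clamp_itv x : a <= clamp x <= b.
Proof. by rewrite /clamp le_max lexx /= ge_max ab ge_min lexx. Qed.

Lemma clamp_id x : a <= x <= b -> clamp x = x.
Proof. by move=> /andP[ax xb]; rewrite /clamp min_r // max_r. Qed.

Lemma clamp_lipschitz x y : `|clamp x - clamp y| <= `|x - y|.
Proof.
wlog xy : x y / x <= y => [hw|].
  by have [/hw //|/ltW /hw] := leP x y; rewrite distrC [leRHS]distrC.
rewrite distrC [leRHS]distrC (ger0_norm (_ : 0 <= y - x)) ?subr_ge0 //.
have ab0 : 0 <= b - a by rewrite subr_ge0.
rewrite /clamp; have [h1|h1] := leP b x; have [h2|h2] := leP b y;
  rewrite ?(max_r ab) ?subrr ?normr0 ?subr_ge0 //.
- by lra.
- by have [h3|h3] := leP a x; rewrite ler_norml; apply/andP; split; lra.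
- have [h3|h3] := leP a x; have [h4|h4] := leP a y;
    by rewrite ler_norml; apply/andP; split; lra.
Qed.

Lemma within_clamp (f : R -> R[i]^o) (h : {additive R[i] -> R}) :
  (forall x, `|h x|%:C <= `|x|) ->
  {within [set x | a <= x <= b], continuous f} ->
  continuous (fun x => h (f (clamp x))).
Proof.
move=> hle /subspace_continuousP cf x; apply/cvgrPdist_lt => e e0.
have /cvgrPdist_lt/(_ e%:C) := cf (clamp x) (clamp_itv x).
rewrite ltcR => /(_ e0) /nbhs_ballP[d /= d0 hd].
apply/nbhs_ballP; exists d => // y xy.
have {}xy : `|x - y| < d by [].
rewrite -raddfB -ltcR; apply: le_lt_trans (hle _) _.
apply: hd; last exact: clamp_itv.
by rewrite -ball_normE /=; apply: le_lt_trans (clamp_lipschitz x y) xy.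
Qed.

Lemma continuous_clamp : continuous clamp.
Proof.
move=> x; apply/cvgrPdist_lt => e e0; apply/nbhs_ballP; exists e => // y xy.
exact: le_lt_trans (clamp_lipschitz x y) _.
Qed.

Lemma bmeas_clamp d (T : measurableType d) (g : T -> R) :
  measurable_fun setT g -> bmeas (fun x => clamp (g x)).
Proof.
move=> mg; split.
  apply: measurableT_comp mg; apply: continuous_measurable_fun.
  exact: continuous_clamp.
exists (`|a| + `|b|) => x; have /andP[h1 h2] := clamp_itv (g x).
have := ler_norm b; have := ler_norm (- a); rewrite normrN ler_norml.
have := normr_ge0 a; have := normr_ge0 b.
by move=> *; apply/andP; split; lra.
Qed.

(** With [w] as a probability density this is a mean of [g]; it locates the eigenvalues of the
    Toeplitz matrices. *)
Lemma weighted_mean_itv d (T : measurableType d) (m : probability T R) (g w : T -> R) :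
  bmeas g -> (forall x, a <= g x <= b) -> bmeas w -> (forall x, 0 <= w x) ->
  \int[m]_x w x = 1 -> a <= \int[m]_x (g x * w x) <= b.
Proof.
move=> bg gab bw w0 w1; have bgw : bmeas (fun z => g z * w z) by exact: bmeasM.
apply/andP; split.
  rewrite -[leLHS]mulr1 -w1 -RintZ //; apply: Rint_le => //; first exact: bmeasZ.
  by move=> z; rewrite ler_wpM2r //; have /andP[] := gab z.
rewrite -[leRHS]mulr1 -w1 -RintZ //; apply: Rint_le => //; first exact: bmeasZ.
by move=> z; rewrite ler_wpM2r //; have /andP[] := gab z.
Qed.

Lemma bmeas_continuous_comp d (T : measurableType d) (f : R -> R) (g : T -> R) :
  continuous f -> bmeas g -> (forall x, a <= g x <= b) -> bmeas (fun x => f (g x)).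
Proof.
move=> cf [mg _] gab; split.
  by apply: measurableT_comp mg; exact: continuous_measurable_fun.
have cfw : {within `[a, b], continuous f} by exact: continuous_subspaceT.
have [c1 _ fc1] := EVT_max ab cfw; have [c2 _ fc2] := EVT_min ab cfw.
exists (`|f c1| + `|f c2|) => x; have gx : g x \in `[a, b] by rewrite in_itv /= gab.
have := fc1 _ gx; have := fc2 _ gx; rewrite ler_norml.
have := ler_norm (f c1); have := ler_norm (- f c2); rewrite normrN.
have := normr_ge0 (f c1); have := normr_ge0 (f c2).
by move=> *; apply/andP; split; lra.
Qed.

End clamp.

Lemma near_all_seq (T : eqType) (s : seq T) (P : nat -> T -> Prop) :
  (forall x, x \in s -> \forall N \near \oo, P N x) ->
  \forall N \near \oo, forall x, x \in s -> P N x.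
Proof.
elim: s => [|x s ih] h; first exact: nearW.
have hx := h x (mem_head x s).
have {}ih := ih (fun y ys => h y (mem_behead (s := x :: s) ys)).
near=> N; move=> y; rewrite inE => /orP[/eqP -> |ys]; first by near: N.
by move: y ys; near: N.
Unshelve. all: by end_near. Qed.

(** The pairs of indices are sorted by their quotient; those with quotient outside [F] are dropped,
    which can only lower the sum as [G] is nonnegative. *)
Lemma sum_quot_count_le (R : realType) (s : {fset nat}) (F : seq rat) (G : rat -> R) :
  uniq F -> (forall q, 0 <= G q) ->
  \sum_(q <- F) G q * (quot_count s q)%:R <=
  \sum_(a < #|` s|) \sum_(b < #|` s|) G ((nth 0%N s a)%:R / (nth 0%N s b)%:R).
Proof.
move=> uF G0.
have E q : G q * (quot_count s q)%:R = \sum_(a < #|` s|) \sum_(b < #|` s|)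
    G q * ((nth 0%N s a)%:R / (nth 0%N s b)%:R == q)%:R.
  rewrite /quot_count (big_nth 0%N) big_mkord natr_sum mulr_sumr.
  apply: eq_bigr => a _; rewrite (big_nth 0%N) big_mkord natr_sum mulr_sumr.
  by [].
under eq_bigr do rewrite E.
rewrite exchange_big; apply: ler_sum => a _.
rewrite exchange_big; apply: ler_sum => b _ /=.
set r := _ / _; have [rF|rF] := boolP (r \in F).
  rewrite (bigD1_seq r) //= eqxx mulr1 big1 ?addr0 // => q.
  by rewrite eq_sym => /negbTE ->; rewrite mulr0.
rewrite big1_seq // => q /andP[_ qF].
by case: eqP => [rq|]; rewrite ?mulr0 //; move: rF; rewrite rq qF.
Qed.

(** * Second moments and limits of spectral averages *)

Section szego.
Variables (R : realType) (m : probability (borel_torus R) R).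
Hypothesis hm : is_haar m.
Variables (sigma : nat -> {fset nat}).
Hypothesis hsigma : multiplicative_folner R sigma.
Variables (g : borel_torus R -> R) (a b : R).
Hypotheses (ab : a <= b) (bg : bmeas g) (gab : forall z, a <= g z <= b).

(** [F] is fixed by Parseval up to [e / 2] before [N] grows; for large [N] each of its finitely many
    quotients then occurs at nearly [#sigma] entries or more. *)
Lemma toeplitz_sqr_deficit (e : R) : 0 < e -> \forall N \near \oo,
  #|` sigma N|%:R * \int[m]_z (g z ^+ 2) -
    \sum_i \sum_j sqn (toeplitz m (fun z => (g z)%:C) (sigma N) i j) <=
  e * #|` sigma N|%:R.
Proof.
move=> e0; have e2 : 0 < e / 2 by rewrite divr_gt0.
have [F [uF F0 hF]] := parseval_lower hm bg e2.
set c := fourier_coef _ _ in hF.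
set K := \sum_(q <- F) _ in hF.
have K0 : 0 <= K by apply: sumr_ge0 => q _; exact: sqn_ge0.
(* This relative loss costs at most [e / 2] after multiplication by [K]; the summand 1 covers
   [K = 0]. *)
have d0 : 0 < e / (2 * (K + 1)) by rewrite divr_gt0 // mulr_gt0 //; lra.
have := @near_all_seq _ F (fun N q => (1 - e / (2 * (K + 1))) * (#|` sigma N|)%:R <=
  (quot_count (sigma N) q)%:R :> R).
move=> /(_ (fun q qF => folner_quot_count hsigma (F0 q qF) d0)); apply: filterS => N hN.
set n := #|` sigma N|%:R in hN *.
have n0 : 0 <= n by rewrite ler0n.
have := @sum_quot_count_le R (sigma N) F (fun q => sqn (c q)) uF (fun q => sqn_ge0 _).
rewrite (_ : \sum_(i < _) _ =
   \sum_i \sum_j sqn (toeplitz m (fun z => (g z)%:C) (sigma N) i j)); last first.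
  by apply: eq_bigr => i _; apply: eq_bigr => j _; rewrite mxE.
set Q := \sum_i _; move=> hQ.
have hK : (1 - e / (2 * (K + 1))) * n * K <= Q.
  apply: le_trans hQ; rewrite /K mulr_sumr big_seq [leRHS]big_seq; apply: ler_sum => q qF.
  by rewrite mulrC ler_wpM2l ?sqn_ge0 // hN.
have hd : e / (2 * (K + 1)) * K <= e / 2.
  have K1 : 0 < 2 * (K + 1) by lra.
  by rewrite mulrAC ler_pdivrMr //; lra.
have h1 : e / (2 * (K + 1)) * K * n <= e / 2 * n by rewrite ler_wpM2r.
have h2 : n * (\int[m]_z (g z ^+ 2)) <= n * (K + e / 2) by rewrite ler_wpM2l //; lra.
have -> : e * n = e / 2 * n + e / 2 * n by field.
have h3 : (1 - e / (2 * (K + 1))) * n * K = n * K - e / (2 * (K + 1)) * K * n by ring.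
lra.
Qed.

(** [lam] and [w] are quantified after [N] because they come from the matrix of index [N]; the
    threshold depends on neither. *)
Lemma szego_average (f : R -> R) (e : R) : continuous f -> 0 < e ->
  \forall N \near \oo, forall (lam : 'I_#|` sigma N| -> R) w,
    (forall i, bmeas (w i) /\ (forall z : borel_torus R, 0 <= w i z)) ->
    (forall z, \sum_i w i z = #|` sigma N|%:R) ->
    (forall i, \int[m]_z w i z = 1 /\ \int[m]_z (g z * w i z) = lam i) ->
    \sum_i lam i ^+ 2 =
      \sum_i \sum_j sqn (toeplitz m (fun z => (g z)%:C) (sigma N) i j) ->
    `|\int[m]_z f (g z) - #|` sigma N|%:R^-1 * \sum_i f (lam i)| <= e.
Proof.
move=> cf e0; have e2 : 0 < e / 2 by rewrite divr_gt0.
have [C C0 hC] := quadratic_modulus ab cf e2.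
(* Chosen so that, times [C], it is at most [e / 2]; the other half of [e] is the additive error of
   [quadratic_modulus]. *)
have d0 : 0 < e / (2 * (C + 1)) by rewrite divr_gt0 // mulr_gt0 //; lra.
have := toeplitz_sqr_deficit d0; apply: filterS => N hN lam w bw wn wlam lam2.
have [s0 _ _] := hsigma.
rewrite -lam2 in hN; set n := #|` sigma N|%:R in hN wn *.
have n0 : 0 < n by rewrite ltr0n cardfs_gt0.
have nI : #|'I_#|` sigma N| |%:R = n by rewrite card_ord.
have bfg := bmeas_continuous_comp ab cf bg gab.
have lamab i : lam i \in `[a, b].
  have [bwi w0] := bw i; have [w1 <-] := wlam i; rewrite in_itv /=.
  exact: weighted_mean_itv.
have fgl i z : `|f (g z) - f (lam i)| <= e / 2 + C * (g z - lam i) ^+ 2.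
  by apply: hC => //; rewrite in_itv /= gab.
(* Applying the estimate to [f] and to [- f] gives the two sides of the absolute value. *)
have up := @Rint_weighted_le _ _ _ m _ g (fun z => f (g z)) w lam
  (fun i => f (lam i)) (e / 2) C bg bfg bw.
have lo := @Rint_weighted_le _ _ _ m _ g (fun z => - f (g z)) w lam
  (fun i => - f (lam i)) (e / 2) C bg (bmeasN bfg) bw.
rewrite nI in up lo.
have {}up := up wn wlam ltac:(by move=> i z; have := fgl i z; rewrite ler_norml => /andP[_]; lra).
have {}lo := lo wn wlam ltac:(by move=> i z; have := fgl i z; rewrite ler_norml => /andP[]; lra).
rewrite RintN // sumrN in lo.
set S := \sum_i f (lam i) in up lo *; set J := \int[m]_z f (g z) in up lo *.
set V := n * _ - _ in hN up lo.
have CV : C * V <= e / 2 * n.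
  apply: le_trans (ler_wpM2l C0 hN) _; rewrite mulrA; apply: ler_wpM2r; first exact: ltW.
  have C1 : 0 < 2 * (C + 1) by lra.
  by rewrite mulrA ler_pdivrMr //; lra.
have -> : J - n^-1 * S = n^-1 * (n * J - S) by rewrite mulrBr mulKf // gt_eqF.
rewrite normrM gtr0_norm ?invr_gt0 // ler_pdivrMl // ler_norml.
by apply/andP; split; lra.
Qed.

End szego.

Lemma toeplitz_eq_off (R : realType) (m : probability (borel_torus R) R)
    (g h : borel_torus R -> R) (N : set (borel_torus R)) (s : {fset nat}) :
  measurable N -> m N = 0 -> (forall z, ~ N z -> h z = g z) -> bmeas g ->
  (forall k, k \in s -> (0 < k)%N) ->
  toeplitz m (fun z => (h z)%:C) s = toeplitz m (fun z => (g z)%:C) s.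
Proof.
move=> mN N0 hg bg s0; apply/matrixP => a b; rewrite !mxE.
set q := _ / _; have q0 : 0 < q by rewrite divr_gt0 // node_gt0.
have [[m1 _] [m2 _]] := cbmeasM (cbmeas_real bg) (cbmeasJ (cbmeas_chi R q0)).
rewrite /fourier_coef /Cintegral.
by congr (_ +i* _); apply: (Rintegral_eq_off mN N0) => // z /hg ->.
Qed.

Theorem theorem3p1 (R : realType)
  (m : probability (borel_torus R) R) (hm : is_haar m)
  (phi : borel_torus R -> R) (hphi : phi \in Lfun m +oo%E)
  (sigma : nat -> {fset nat}) (hsigma : multiplicative_folner R sigma)
  (f : R -> R[i]^o)
  (hf : {within ess_range_itv m phi, continuous f}) :
  ((#|` sigma N|%:R)^-1
     * \tr (hermitian_fun f (toeplitz m (fun z => (phi z)%:C) (sigma N)))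
   : R[i]^o) @[N --> \oo]
  --> (Cintegral m (fun z => f (phi z)) : R[i]^o).
Proof.
have [a [b [ab mphi Ea Eb [Z [mZ Z0 phiab]]]]] := Lfun_infty_bounds hphi.
have [_ s0 _] := hsigma.
pose g z := clamp a b (phi z).
have gab z : a <= g z <= b by exact: clamp_itv.
have bg : bmeas g by exact: bmeas_clamp.
have phig z : ~ Z z -> phi z = g z by move=> /phiab /clamp_id.
have cf : {within [set x | a <= x <= b], continuous f}.
  suff <- : ess_range_itv m phi = [set x | a <= x <= b] by [].
  by rewrite /ess_range_itv Ea Eb; apply/seteqP; split=> x /=; rewrite !lee_fin.
(* The real and imaginary parts of [f], extended by constants outside [[a, b]], are treated
   separately as real test functions. *)
pose f1 x := complex.Re (f (clamp a b x)); pose f2 x := complex.Im (f (clamp a b x)).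
have cf1 : continuous f1 by exact: (within_clamp ab (@normc_ge_Re R) cf).
have cf2 : continuous f2 by exact: (within_clamp ab (@normc_ge_Im R) cf).
have fE x : a <= x <= b -> f x = f1 x +i* f2 x.
  by move=> xab; rewrite /f1 /f2 clamp_id //; case: (f x).
have -> : Cintegral m (fun z => f (phi z)) =
    (\int[m]_z f1 (g z)) +i* (\int[m]_z f2 (g z)).
  have [m1 _] := bmeas_continuous_comp ab cf1 bg gab.
  have [m2 _] := bmeas_continuous_comp ab cf2 bg gab.
  rewrite /Cintegral; congr (_ +i* _); apply: (Rintegral_eq_off mZ Z0) => // z /phig ->.
    by rewrite fE.
  by rewrite fE.
apply/cvgrPdist_le => e e0.
(* The tolerance [e] is an element of [R[i]], real as it is positive; half of it goes to each of the
   two parts. *)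
have eE : e = (complex.Re e)%:C by rewrite RRe_real // ger0_real // ltW.
have e2 : 0 < complex.Re e / 2 by rewrite divr_gt0 //; move: e0; rewrite eE ltcR.
have h1 := szego_average hm hsigma ab bg gab cf1 e2.
have h2 := szego_average hm hsigma ab bg gab cf2 e2.
apply: filterS2 h1 h2 => N h1 h2.
rewrite (toeplitz_eq_off mZ Z0 phig bg (s0 N)).
have [lam [w [bw wn wl l2 ->]]] := toeplitz_spectrum hm (s0 N) bg.
have {}h1 := h1 lam w bw wn wl l2; have {}h2 := h2 lam w bw wn wl l2.
(* The eigenvalues must lie in [[a, b]] for [f] to be replaced by [f1] and [f2] at them. *)
have lamab i : a <= lam i <= b.
  by have [bwi w0] := bw i; have [w1 <-] := wl i; exact: weighted_mean_itv.
set J1 := \int[m]_z f1 _ in h1 *; set J2 := \int[m]_z f2 _ in h2 *.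
have -> : (#|` sigma N|%:R : R[i])^-1 * \sum_i f (lam i) =
    (#|` sigma N|%:R^-1 * \sum_i f1 (lam i)) +i* (#|` sigma N|%:R^-1 * \sum_i f2 (lam i)).
  have -> : (#|` sigma N|%:R : R[i])^-1 = (#|` sigma N|%:R^-1)%:C by rewrite fmorphV rmorph_nat.
  apply/eqP; rewrite eq_complex Re_mul Im_mul /= !mul0r subr0 addr0 !raddf_sum /=.
  by apply/andP; split; apply/eqP; congr (_ * _); apply: eq_bigr => i _; rewrite fE.
rewrite eE; apply: le_trans (norm_le_ReIm _) _; rewrite lecR /=.
by rewrite [leRHS]splitr lerD.
Qed.
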